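(* Consider the exponential random graph model (ERGM) on $n$ vertices with fixed graphs $H_1,\dots,H_k$ and parameters $\beta$ in the subcritical region, as in the context. Let $H$ be any fixed simple graph, possibly with isolated vertices, with $e=|\mathcal{E}(H)|\ge1$ edges and $v=|\mathcal{V}(H)|\ge3$ vertices. Then $$\mathrm{Var}\Big(|\mathrm{Hom}(H,G_Y)|-2n^{v-2}e\,p^{e-1}\Big(\sum_{1\le i<j\le n}Y_{ij}-\mu_n\Big)\Big)=O\big(n^{2v-\frac52}\big),$$ that is, the left-hand side is at most $Cn^{2v-5/2}$ for all $n\ge2$, with $C$ depending only on $\beta_1,\dots,\beta_k$, $H_1,\dots,H_k$ and $H$.
   Context: Graphs are simple (undirected, no loops or multiple edges). Let $k\ge1$; $H_1$ is a single edge, $H_2,\dots,H_k$ are fixed simple graphs without isolated vertices, each having at least two edges; $\beta_1\in\mathbb{R}$ and $\beta_2,\dots,\beta_k>0$. Let $v_j=|\mathcal{V}(H_j)|$ and $e_j$ be the numbers of vertices and edges of $H_j$. For graphs $H,G$, $|\mathrm{Hom}(H,G)|$ is the number of injective maps $\mathcal{V}(H)\to\mathcal{V}(G)$ sending every edge of $H$ to an edge of $G$. The ERGM is the random graph $G_Y$ on vertex set $\{1,\dots,n\}$ whose edge indicators $Y=(Y_{ij})_{1\le i<j\le n}\in\{0,1\}^{\binom n2}$ have probability mass function $$p_\beta(y)=\frac1{Z(\beta)}\exp\Big\{\sum_{j=1}^k\frac{\beta_j}{n^{v_j-2}}|\mathrm{Hom}(H_j,G_y)|\Big\},$$ where $G_y$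 is the graph with edge indicators $y$ and $Z(\beta)$ is the normalizing constant. Put $\mu_n=\mathbb{E}\sum_{1\le i<j\le n}Y_{ij}$. Define $\Phi_\beta(a)=\sum_{i=1}^k\beta_ie_ia^{e_i-1}$ and $\varphi_\beta(a)=\frac{e^{2\Phi_\beta(a)}}{e^{2\Phi_\beta(a)}+1}$. The subcritical region is the set of $\beta$ for which the equation $\varphi_\beta(a)=a$ has a unique solution $p=p(\beta)$ in $(0,1)$ and $\varphi_\beta'(p)<1$. Throughout $p$ denotes this solution. *)

(* Defs.v *)
From HB Require Import structures.
From mathcomp Require Import all_boot all_order all_algebra.
From mathcomp Require Import all_classical all_reals all_analysis.

Set Implicit Arguments.
Unset Strict Implicit.
Unset Printing Implicit Defensive.

Import Order.TTheory GRing.Theory Num.Theory.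
Local Open Scope ring_scope.

Record sgraph := SGraph {
  vertex :> finType;
  adj : rel vertex;
  adj_sym : symmetric adj;
  adj_irr : irreflexive adj }.

Definition edges (G : sgraph) : {set {set G}} :=
  [set [set xy.1; xy.2] | xy : G * G & adj xy.1 xy.2].

Definition nvert (G : sgraph) : nat := #|G|.
Definition nedge (G : sgraph) : nat := #|edges G|.

Definition no_isolated (G : sgraph) : Prop := forall x : G, exists y, adj x y.

Definition single_edge (G : sgraph) : Prop := nvert G = 2%N /\ nedge G = 1%N.

(* This is what is written Hom(H, G): all maps in it are injective. *)
Definition injhom (H G : sgraph) : {set {ffun H -> G}} :=
  [set f : {ffun H -> G} | injectiveb f &&
     [forall x, forall y, adj x y ==> adj (f x) (f y)]].

(* The C(n,2) potential edges on the vertex set 'I_n. *)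
Definition vpair (n : nat) : finType := {ij : 'I_n * 'I_n | (ij.1 < ij.2)%N}.

Definition config (n : nat) : finType := {ffun vpair n -> bool}.

Definition config_adj n (y : config n) : rel 'I_n :=
  fun a b => [exists ij : vpair n,
    y ij && ((val ij == (a, b)) || (val ij == (b, a)))].

Lemma config_adj_sym n (y : config n) : symmetric (config_adj y).
Proof. by move=> a b; apply: eq_existsb => ij; rewrite orbC. Qed.

Lemma config_adj_irr n (y : config n) : irreflexive (config_adj y).
Proof.
move=> a; apply/existsP => -[[ij /= lt_ij]] /andP[_].
by rewrite orbb => /eqP e; move: lt_ij; rewrite e ltnn.
Qed.

Definition config_graph n (y : config n) : sgraph :=
  SGraph (config_adj_sym y) (@config_adj_irr n y).

Section ERGM.
Variables (R : realType) (k : nat) (H : 'I_k.+1 -> sgraph) (beta : 'I_k.+1 -> R).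

(* The subtractions in [nat] below are never truncated, since every graph
   considered has an edge. *)
Definition ergm_weight n (y : config n) : R :=
  expR (\sum_(j < k.+1) beta j / n%:R ^+ (nvert (H j) - 2)
                        * #|injhom (H j) (config_graph y)|%:R).

Definition ergm_Z n : R := \sum_(y : config n) ergm_weight y.

Definition ergm_pmf n (y : config n) : R := ergm_weight y / ergm_Z n.

Definition ergm_E n (X : config n -> R) : R :=
  \sum_(y : config n) ergm_pmf y * X y.

Definition ergm_Var n (X : config n -> R) : R :=
  ergm_E (fun y => (X y - ergm_E X) ^+ 2).

Definition edge_sum n (y : config n) : R := \sum_(ij : vpair n) (y ij)%:R.

Definition ergm_mu n : R := ergm_E (@edge_sum n).

Definition Phi (a : R) : R :=
  \sum_(i < k.+1) beta i * (nedge (H i))%:R * a ^+ (nedge (H i) - 1).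

Definition phi (a : R) : R := expR (2 * Phi a) / (expR (2 * Phi a) + 1).

(* [beta] is in the subcritical region, with p(beta) = p. *)
Definition subcritical_at (p : R) : Prop :=
  unique (fun a => 0 < a < 1 /\ phi a = a) p /\ derive1 phi p < 1.

End ERGM.

(* Main.v *)
(* The model is ferromagnetic, so its law is positively associated (FKG), and
   every bound is static.  Write sigma_e for the conditional probability of the
   edge e given the rest; it is a logistic function of a local subgraph count.

   Step 1.  Replacing the edges one at a time by independent Bernoulli(a)
   variables changes the expectation of a monotone function g by at most
   sum_e |D_e g| P(sigma_e on the wrong side of a).  Applied to smoothed
   indicators of local counts, which concentrate under the product measure,
   this turns "sigma_e <= a with high probability" into
   "sigma_e <= phi(a) + O(n^(-1/4)) with high probability", and symmetrically
   from below.  Since phi contracts towards p, iterating from the trivial bounds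
   0 <= sigma_e <= 1 shows that all local counts are within O(n^(-1/4)) of their
   values at density p, except with superpolynomially small probability.

   Step 2.  Let Y be the number of edges and S the sum of the sigma_e.  Off the
   bad event rho Y - S is increasing for some rho < 1 close to phi'(p), so
   association gives Cov(Y, S) <= rho Var Y + o(1), while
   Var Y - Cov(Y, S) <= n^2; hence Var Y = O(n^2).

   Step 3.  Let X = |Hom(H)| - c Y with c = 2 e n^(v-2) p^(e-1).  Off the bad
   event every |D_e X| is at most r = O(n^(v-2-1/4)), so r Y + X and r Y - X are
   increasing there and 0 <= Cov(r Y + X, r Y - X) + o(1)
   = r^2 Var Y - Var X + o(1). *)
Require Import Defs.
From HB Require Import structures.
From mathcomp Require Import all_boot all_order all_algebra fingroup perm.
From mathcomp Require Import all_classical all_reals all_analysis.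
From mathcomp Require Import ring lra zify.

Set Implicit Arguments.
Unset Strict Implicit.
Unset Printing Implicit Defensive.

Import Order.TTheory GRing.Theory Num.Theory.
Import numFieldNormedType.Exports.
Local Open Scope ring_scope.

(** * Functions on the discrete cube and their discrete derivatives *)

Section Cube.
Variables (R : realType) (I : finType).
Implicit Types (y z : {ffun I -> bool}) (e : I) (F g : {ffun I -> bool} -> R).

(** Why eps is of order n^(-1/4). A local count has influences at most K/n with sum at most K, so
    under a product measure it deviates by eps with probability exp(- c eps^2 n). One comparison
    multiplies the failure probability by about K/eps, the slope of the smoothed indicator times the
    total influence. With l of order n^(1/8), O(l^2) comparisons bring the radius down to order eps.
    For eps = l^(-2) their total loss exp(O(l^3)) is beaten by exp(- c l^4).

    The main obstacle is that a monotone path between two typical configurations may leave the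
    typical set. Mixed second differences of the polynomials involved are nonnegative, so a discrete
    derivative along the path lies between its values at the two ends, and only the ends need be
    typical.

    The sign of [beta] at [ord0] is free because monomials of degree one are modular and have no
    second differences.

    The iteration starts from the trivial bounds, so the contraction towards p must hold on all of
    [0,1]; the slope at p alone would not do. Uniqueness of the fixed point supplies this. *)

Definition put y e b : {ffun I -> bool} := [ffun i => if i == e then b else y i].

Definition cle y z : bool := [forall i, y i ==> z i].

Definition cjoin y z : {ffun I -> bool} := [ffun i => y i || z i].

Definition cmeet y z : {ffun I -> bool} := [ffun i => y i && z i].

Definition disc e F y : R := F (put y e true) - F (put y e false).

Lemma cleP y z : reflect (forall i, y i -> z i) (cle y z).
Proof.
apply: (iffP forallP) => h i; first by move/(_ i)/implyP: h.
by apply/implyP/h.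
Qed.

Lemma cle_refl y : cle y y. Proof. by apply/cleP. Qed.

Lemma cle_trans y z x : cle x y -> cle y z -> cle x z.
Proof. by move=> /cleP h /cleP h'; apply/cleP => i /h /h'. Qed.

Lemma putE y e b i : put y e b i = if i == e then b else y i.
Proof. by rewrite ffunE. Qed.

Lemma put_id y e : put y e (y e) = y.
Proof. by apply/ffunP => i; rewrite putE; case: eqP => [->|]. Qed.

Lemma put_put y e b c : put (put y e b) e c = put y e c.
Proof. by apply/ffunP => i; rewrite !putE; case: eqP. Qed.

Lemma put_comm y e e' b c : e != e' ->
  put (put y e b) e' c = put (put y e' c) e b.
Proof.
move=> ne; apply/ffunP => i; rewrite !putE.
by case: (i =P e') => [->|//]; rewrite eq_sym (negbTE ne).
Qed.

Lemma put_le y e : cle (put y e false) y && cle y (put y e true).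
Proof.
by apply/andP; split; apply/cleP => i; rewrite putE; case: eqP.
Qed.

Lemma disc_put e F y b : disc e F (put y e b) = disc e F y.
Proof. by rewrite /disc !put_put. Qed.

Lemma eq_disc e F g y : F =1 g -> disc e F y = disc e g y.
Proof. by move=> h; rewrite /disc !h. Qed.

(** Flipping the coordinate [e] is an involution, so each pair of configurations that differ only at
    [e] is met twice; hence the division by 2. *)
Lemma sum_put e F :
  \sum_y F y = (\sum_y (F (put y e false) + F (put y e true))) / 2.
Proof.
pose fl y := put y e (~~ y e).
have flK : involutive fl.
  by move=> y; rewrite /fl putE eqxx negbK put_put put_id.
have -> : \sum_y (F (put y e false) + F (put y e true)) = \sum_y (F y + F (fl y)).
  apply: eq_bigr => y _; rewrite /fl -{3}(put_id y e).
  by case: (y e) => //=; rewrite addrC.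
rewrite big_split /= [\sum_y F (fl y)](_ : _ = \sum_y F y); first by field.
by rewrite [RHS](reindex_inj (inv_inj flK)).
Qed.

(** * The four functions theorem and association *)

Definition psum e F y : R := F (put y e false) + F (put y e true).

(** Coordinates are summed out without leaving the cube: the result no longer depends on them. This
    keeps the induction on [s] free of changing index types, at the price of a factor 2 per
    coordinate in [sum_psums]. *)
Fixpoint psums (s : seq I) F : {ffun I -> bool} -> R :=
  if s is e :: s' then psums s' (psum e F) else F.

Lemma sum_psums (s : seq I) F : \sum_y psums s F y = 2 ^+ size s * \sum_y F y.
Proof.
elim: s F => [|e s IH] F /=; first by rewrite expr0 mul1r.
rewrite IH exprS (sum_put e F) /psum; by field.
Qed.

(** The four functions theorem for one coordinate. With x = c1 d0, both u = a0 b1 and v = a1 b0 are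
    at most x, and u v <= x c0 d1. Expanding (x - u)(x - v) >= 0 and dividing by x gives u + v <= x
    + c0 d1; if x = 0 then u = v = 0. *)
Lemma four_points (a0 a1 b0 b1 c0 c1 d0 d1 : R) :
  0 <= a0 -> 0 <= a1 -> 0 <= b0 -> 0 <= b1 ->
  0 <= c0 -> 0 <= c1 -> 0 <= d0 -> 0 <= d1 ->
  a0 * b0 <= c0 * d0 -> a0 * b1 <= c1 * d0 ->
  a1 * b0 <= c1 * d0 -> a1 * b1 <= c1 * d1 ->
  (a0 + a1) * (b0 + b1) <= (c0 + c1) * (d0 + d1).
Proof.
move=> a0p a1p b0p b1p c0p c1p d0p d1p h00 h01 h10 h11.
have [z|nz] := eqVneq (c1 * d0) 0.
  have e1 : a0 * b1 = 0 by apply/eqP; rewrite eq_le mulr_ge0 // -z h01.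
  have e2 : a1 * b0 = 0 by apply/eqP; rewrite eq_le mulr_ge0 // -z h10.
  have := mulr_ge0 c0p d1p; nra.
have xp : 0 < c1 * d0 by rewrite lt_def nz mulr_ge0.
set x := c1 * d0 in xp h01 h10 nz.
set u := a0 * b1 in h01; set v := a1 * b0 in h10.
have up : 0 <= u by apply: mulr_ge0.
have vp : 0 <= v by apply: mulr_ge0.
have key : u * v <= (c0 * d1) * x.
  have -> : u * v = (a0 * b0) * (a1 * b1) by rewrite /u /v; ring.
  have -> : c0 * d1 * x = (c0 * d0) * (c1 * d1) by rewrite /x; ring.
  by apply: ler_pM => //; apply: mulr_ge0.
have : 0 <= (x - u) * (x - v) by apply: mulr_ge0; rewrite subr_ge0.
move=> key2.
have : u + v <= x + c0 * d1.
  rewrite -(ler_pM2r xp); nra.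
rewrite /u /v /x; nra.
Qed.

Lemma cjoin_put y z e b c :
  cjoin (put y e b) (put z e c) = put (cjoin y z) e (b || c).
Proof. by apply/ffunP => i; rewrite !ffunE; case: eqP. Qed.

Lemma cmeet_put y z e b c :
  cmeet (put y e b) (put z e c) = put (cmeet y z) e (b && c).
Proof. by apply/ffunP => i; rewrite !ffunE; case: eqP. Qed.

Lemma psums_four (s : seq I) (A B C D : {ffun I -> bool} -> R) :
  (forall y, 0 <= A y) -> (forall y, 0 <= B y) ->
  (forall y, 0 <= C y) -> (forall y, 0 <= D y) ->
  (forall y z, A y * B z <= C (cjoin y z) * D (cmeet y z)) ->
  forall y z,
    psums s A y * psums s B z <= psums s C (cjoin y z) * psums s D (cmeet y z).
Proof.
elim: s A B C D => [|e s IH] A B C D Ap Bp Cp Dp h //=.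
apply: IH => [y|y|y|y|y z]; rewrite ?addr_ge0 // /psum.
apply: four_points => //.
- by have := h (put y e false) (put z e false); rewrite cjoin_put cmeet_put.
- by have := h (put y e false) (put z e true); rewrite cjoin_put cmeet_put.
- by have := h (put y e true) (put z e false); rewrite cjoin_put cmeet_put.
- by have := h (put y e true) (put z e true); rewrite cjoin_put cmeet_put.
Qed.

(** The list [t] collects the coordinates already summed out, which makes the statement inductive in
    [s]. *)
Lemma psums_indep (s t : seq I) F :
  (forall y z, (forall i, i \notin t -> y i = z i) -> F y = F z) ->
  forall y z, (forall i, i \notin s -> i \notin t -> y i = z i) ->
  psums s F y = psums s F z.
Proof.
elim: s t F => [|e s IH] t F hF y z h /=; first by apply: hF => i; apply: h.
apply: (IH (e :: t)) => [y' z' h'|i nis].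
  congr (_ + _); apply: hF => i nit; rewrite !putE; case: eqP => // /eqP ne;
    by apply: h'; rewrite inE negb_or ne.
by rewrite inE negb_or => /andP[ne nit]; apply: h; rewrite // inE negb_or ne.
Qed.

(** The Ahlswede-Daykin theorem. Once all coordinates are summed out the four functions are constant
    and equal to their totals up to a common factor, so the pointwise inequality of [psums_four] at
    a single point is the claim. *)
Lemma four_functions (A B C D : {ffun I -> bool} -> R) :
  (forall y, 0 <= A y) -> (forall y, 0 <= B y) ->
  (forall y, 0 <= C y) -> (forall y, 0 <= D y) ->
  (forall y z, A y * B z <= C (cjoin y z) * D (cmeet y z)) ->
  (\sum_y A y) * (\sum_y B y) <= (\sum_y C y) * (\sum_y D y).
Proof.
move=> Ap Bp Cp Dp h.
pose y0 : {ffun I -> bool} := [ffun=> false].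
have cst F y : psums (enum I) F y = psums (enum I) F y0.
  apply: (@psums_indep _ [::]) => [x z e|i]; first by congr F; apply/ffunP => i; apply: e.
  by rewrite mem_enum.
have tot F : #|{ffun I -> bool}|%:R * psums (enum I) F y0
    = 2 ^+ size (enum I) * \sum_y F y.
  rewrite -sum_psums (eq_bigr (fun=> psums (enum I) F y0)) ?sumr_const ?mulr_natl //.
have cp : 0 < (#|{ffun I -> bool}|%:R : R).
  by rewrite ltr0n; apply/card_gt0P; exists y0.
have dp : 0 < (2 ^+ size (enum I) : R) by apply: exprn_gt0.
have tot' F : \sum_y F y =
    #|{ffun I -> bool}|%:R / 2 ^+ size (enum I) * psums (enum I) F y0.
  by rewrite mulrAC tot mulrAC divff ?mul1r // lt0r_neq0.
set k := (#|{ffun I -> bool}|%:R / 2 ^+ size (enum I) : R) in tot'.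
have kp : 0 < k by apply: divr_gt0.
rewrite !tot' [k * _ * _]mulrACA [leRHS]mulrACA ler_pM2l ?mulr_gt0 //.
have := psums_four (enum I) Ap Bp Cp Dp h y0 y0.
by rewrite (cst C (cjoin _ _)) (cst D (cmeet _ _)).
Qed.

(** * Gibbs measures on the cube *)

Variable w : {ffun I -> bool} -> R.
Hypothesis w_gt0 : forall y, 0 < w y.

Definition gibbs_E F : R := \sum_y w y / (\sum_z w z) * F y.

Definition gibbs_P (A : pred {ffun I -> bool}) : R := gibbs_E (fun y => (A y)%:R).

Definition gibbs_cov F g : R :=
  gibbs_E (fun y => F y * g y) - gibbs_E F * gibbs_E g.

Definition cond_prob e y : R :=
  w (put y e true) / (w (put y e false) + w (put y e true)).

Lemma part_gt0 : 0 < \sum_z w z.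
Proof.
rewrite (bigD1 [ffun=> false]) //= ltr_pwDl // sumr_ge0 // => y _.
exact: ltW.
Qed.

Lemma gibbs_ge0 y : 0 <= w y / (\sum_z w z).
Proof. by rewrite divr_ge0 // ltW // part_gt0. Qed.

Lemma gibbs_sum1 : \sum_y w y / (\sum_z w z) = 1.
Proof. by rewrite -mulr_suml divff // lt0r_neq0 // part_gt0. Qed.

Lemma gibbs_E_cst (c : R) : gibbs_E (fun=> c) = c.
Proof. by rewrite /gibbs_E -mulr_suml gibbs_sum1 mul1r. Qed.

Lemma gibbs_ED F g : gibbs_E (fun y => F y + g y) = gibbs_E F + gibbs_E g.
Proof.
by rewrite /gibbs_E -big_split /=; apply: eq_bigr => y _; rewrite mulrDr.
Qed.

Lemma gibbs_EZ (c : R) F : gibbs_E (fun y => c * F y) = c * gibbs_E F.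
Proof.
by rewrite /gibbs_E mulr_sumr; apply: eq_bigr => y _; rewrite mulrCA.
Qed.

Lemma gibbs_EB F g : gibbs_E (fun y => F y - g y) = gibbs_E F - gibbs_E g.
Proof.
rewrite -mulN1r -gibbs_EZ -gibbs_ED /gibbs_E.
by apply: eq_bigr => y _; rewrite mulN1r.
Qed.

Lemma gibbs_E_sum (J : finType) (F : J -> {ffun I -> bool} -> R) :
  gibbs_E (fun y => \sum_j F j y) = \sum_j gibbs_E (F j).
Proof.
rewrite /gibbs_E exchange_big /=.
by apply: eq_bigr => y _; rewrite mulr_sumr.
Qed.

Lemma eq_gibbs_E F g : F =1 g -> gibbs_E F = gibbs_E g.
Proof. by move=> h; apply: eq_bigr => y _; rewrite h. Qed.

Lemma le_gibbs_E F g : (forall y, F y <= g y) -> gibbs_E F <= gibbs_E g.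
Proof. by move=> h; apply: ler_sum => y _; rewrite ler_wpM2l // gibbs_ge0. Qed.

Lemma gibbs_E_ge0 F : (forall y, 0 <= F y) -> 0 <= gibbs_E F.
Proof. by move=> h; rewrite -(gibbs_E_cst 0); apply: le_gibbs_E. Qed.

Lemma le_gibbs_P (A B : pred {ffun I -> bool}) :
  (forall y, A y -> B y) -> gibbs_P A <= gibbs_P B.
Proof.
move=> h; apply: le_gibbs_E => y; rewrite ler_nat.
by case: (A y) (h y) => // ->.
Qed.

Lemma gibbs_P_exists (J : finType) (A : J -> pred {ffun I -> bool}) :
  gibbs_P (fun y => [exists j, A j y]) <= \sum_j gibbs_P (A j).
Proof.
rewrite /gibbs_P -gibbs_E_sum; apply: le_gibbs_E => y.
case: existsP => [[j Aj]|_]; last by apply: sumr_ge0 => j _; rewrite ler0n.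
by rewrite (bigD1 j) //= Aj lerDl sumr_ge0 // => i _; rewrite ler0n.
Qed.

(** On each pair of configurations differing at [e] the function [F] is constant, and the weighted
    values of [y e - cond_prob e y] cancel. This is the defining property of a conditional
    probability. *)
Lemma gibbs_cond e F : (forall y b, F (put y e b) = F y) ->
  gibbs_E (fun y => ((y e)%:R - cond_prob e y) * F y) = 0.
Proof.
move=> h; rewrite /gibbs_E [LHS](sum_put e) big1 ?mul0r // => y _.
rewrite /cond_prob /= !h !putE eqxx !put_put.
set Z := \sum_z w z; have Zp : 0 < Z by apply: part_gt0.
have := w_gt0 (put y e false); have := w_gt0 (put y e true).
set a := w _; set b := w _ => ap bp.
rewrite mulr1n mulr0n; field; rewrite !lt0r_neq0 //; exact: addr_gt0.
Qed.

Lemma cond_prob01 e y : 0 <= cond_prob e y <= 1.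
Proof.
have := w_gt0 (put y e false); have := w_gt0 (put y e true).
rewrite /cond_prob; set a := w _; set b := w _ => ap bp.
have sp := addr_gt0 bp ap.
by apply/andP; split; [rewrite divr_ge0 ?ltW|rewrite ler_pdivrMr ?mul1r ?lerDr ?ltW].
Qed.

Hypothesis w_supermod :
  forall y z, w y * w z <= w (cjoin y z) * w (cmeet y z).

Definition increasing_on (G : pred {ffun I -> bool}) F :=
  forall y z, G y -> G z -> cle y z -> F y <= F z.

Lemma cjoin_gel y z : cle y (cjoin y z).
Proof. by apply/cleP => i; rewrite ffunE => ->. Qed.

Lemma cjoin_ger y z : cle z (cjoin y z).
Proof. by apply/cleP => i; rewrite ffunE => ->; rewrite orbT. Qed.

(** The FKG inequality, from the four functions m F, m g, m F g and m, where m is the probability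
    mass function. Nonnegativity is what the four functions theorem asks for; [gibbs_cov_shift]
    removes it for bounded functions. *)
Lemma gibbs_cov_ge0 F g : increasing_on predT F -> increasing_on predT g ->
  (forall y, 0 <= F y) -> (forall y, 0 <= g y) -> 0 <= gibbs_cov F g.
Proof.
move=> iF ig F0 g0; rewrite /gibbs_cov subr_ge0.
have Zp := part_gt0.
pose m y := w y / \sum_z w z.
have m0 y : 0 <= m y by apply: gibbs_ge0.
have := @four_functions (fun y => m y * F y) (fun y => m y * g y)
  (fun y => m y * (F y * g y)) m.
have -> : \sum_y m y = 1 by apply: gibbs_sum1.
rewrite mulr1; apply.
- by move=> y; apply: mulr_ge0; [exact: m0|exact: F0].
- by move=> y; apply: mulr_ge0; [exact: m0|exact: g0].
- by move=> y; apply: mulr_ge0; [exact: m0|exact: mulr_ge0].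
- exact: m0.
move=> y z; rewrite /m.
have : F y * g z <= F (cjoin y z) * g (cjoin y z).
  by apply: ler_pM => //; [apply: iF|apply: ig]; rewrite // ?cjoin_gel ?cjoin_ger.
set f1 := F y; set g1 := g z; set f2 := F _; set g2 := g _ => fg.
set Z := \sum_z w z in Zp *.
have -> : w y / Z * f1 * (w z / Z * g1) = (w y * w z) * (f1 * g1) / Z ^+ 2.
  by field; rewrite lt0r_neq0.
have -> : w (cjoin y z) / Z * (f2 * g2) * (w (cmeet y z) / Z)
   = (w (cjoin y z) * w (cmeet y z)) * (f2 * g2) / Z ^+ 2.
  by field; rewrite lt0r_neq0.
rewrite ler_pM2r ?invr_gt0 ?exprn_gt0 //.
by apply: ler_pM => //; apply: mulr_ge0; rewrite ?F0 ?g0 // ltW.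
Qed.

(** The extension at [z] is the largest value of [F] on the part of [G] below [z]. It agrees with
    [F] on [G] exactly because [F] is increasing there. *)
Lemma increasing_extension (G : pred {ffun I -> bool}) F (B : R) :
  increasing_on G F -> (forall y, `|F y| <= B) ->
  exists2 F', increasing_on predT F' &
    (forall y, `|F' y| <= B) /\ (forall y, G y -> F' y = F y).
Proof.
move=> iF bF.
have B0 : 0 <= B by apply: le_trans (normr_ge0 _) (bF [ffun=> false]).
(* The default [- B] serves configurations with no point of [G] below them and preserves the bound
   [B]. *)
pose F' z := \big[Num.max/ - B]_(y | G y && cle y z) F y.
exists F' => [y z _ _ yz|].
  apply: bigmax_le => [|x /andP[Gx xy]]; first exact: bigmax_ge_id.
  by apply: le_bigmax_cond; rewrite Gx (cle_trans xy).
split=> [y|y Gy].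
  rewrite ler_norml bigmax_ge_id /=; apply: bigmax_le => [|x _].
    by rewrite ge0_cp.
  by have := bF x; rewrite ler_norml => /andP[].
apply/eqP; rewrite eq_le; apply/andP; split.
  apply: bigmax_le => [|x /andP[Gx xy]]; last exact: iF.
  by have := bF y; rewrite ler_norml => /andP[].
by apply: le_bigmax_cond; rewrite Gy cle_refl.
Qed.

Lemma gibbs_cov_shift F g (a b : R) :
  gibbs_cov (fun y => F y + a) (fun y => g y + b) = gibbs_cov F g.
Proof.
rewrite /gibbs_cov !gibbs_ED !gibbs_E_cst.
have -> : gibbs_E (fun y => (F y + a) * (g y + b)) =
    gibbs_E (fun y => F y * g y) + b * gibbs_E F + a * gibbs_E g + a * b.
  rewrite -[a * b]gibbs_E_cst -!gibbs_EZ -!gibbs_ED.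
  by apply: eq_gibbs_E => y; ring.
by ring.
Qed.

(* Functions that are increasing only on a set of probability close to one are
   replaced by increasing functions agreeing with them there. *)
Lemma approx_association (G : pred {ffun I -> bool}) F g (B C : R) :
  increasing_on G F -> increasing_on G g ->
  (forall y, `|F y| <= B) -> (forall y, `|g y| <= C) ->
  - (6 * B * C * gibbs_P (predC G)) <= gibbs_cov F g.
Proof.
move=> iF ig bF bg.
have [F' iF' [bF' eF]] := increasing_extension iF bF.
have [g' ig' [bg' eg]] := increasing_extension ig bg.
have B0 : 0 <= B by apply: le_trans (normr_ge0 _) (bF [ffun=> false]).
have C0 : 0 <= C by apply: le_trans (normr_ge0 _) (bg [ffun=> false]).
have cov0 : 0 <= gibbs_cov F' g'.
  (* Adding the bounds [B] and [C] makes both functions nonnegative and leaves the covariance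
     unchanged. *)
  rewrite -(gibbs_cov_shift _ _ B C); apply: gibbs_cov_ge0.
  - by move=> y z _ _ yz; rewrite lerD2r iF'.
  - by move=> y z _ _ yz; rewrite lerD2r ig'.
  - by move=> y; have := bF' y; rewrite ler_norml -subr_ge0 opprK => /andP[].
  - by move=> y; have := bg' y; rewrite ler_norml -subr_ge0 opprK => /andP[].
set P := gibbs_P _.
have dE (h h' : {ffun I -> bool} -> R) (D : R) : (forall y, `|h y| <= D) ->
    (forall y, `|h' y| <= D) -> (forall y, G y -> h' y = h y) ->
    `|gibbs_E h - gibbs_E h'| <= 2 * D * P.
  move=> bh bh' e; rewrite -gibbs_EB /P /gibbs_P -gibbs_EZ.
  have aux y : `|h y - h' y| <= 2 * D * (predC G y)%:R.
    rewrite /=; case Gy: (G y) => /=; first by rewrite e // subrr normr0 mulr0n mulr0.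
    apply: le_trans (ler_normB _ _) _; rewrite mulr1n mulr1 mulr_natl mulr2n.
    exact: lerD.
  rewrite ler_norml -mulN1r -gibbs_EZ; apply/andP; split; apply: le_gibbs_E => y;
    by have := aux y; rewrite ler_norml ?mulN1r => /andP[].
have bE (h : {ffun I -> bool} -> R) (D : R) : (forall y, `|h y| <= D) ->
    `|gibbs_E h| <= D.
  move=> bh; rewrite ler_norml -{1}(gibbs_E_cst (- D)) -{2}(gibbs_E_cst D).
  by apply/andP; split; apply: le_gibbs_E => y; have := bh y;
    rewrite ler_norml => /andP[].
have h1 := dE _ _ _ bF bF' eF.
have h2 := dE _ _ _ bg bg' eg.
(* The constant 6 is 2 + 2 + 2: one term for the product, one for replacing [F] and one for
   replacing [g] in the product of the means. *)
have h3 : `|gibbs_E (fun y => F y * g y) - gibbs_E (fun y => F' y * g' y)|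
    <= 2 * (B * C) * P.
  apply: dE => [y|y|y Gy]; rewrite ?normrM ?ler_pM //.
  by rewrite eF ?eg.
have h4 := bE _ _ bF; have h5 := bE _ _ bg'.
have h6 : `|(gibbs_E F - gibbs_E F') * gibbs_E g'| <= 2 * B * P * C.
  by rewrite normrM ler_pM.
have h7 : `|gibbs_E F * (gibbs_E g - gibbs_E g')| <= B * (2 * C * P).
  by rewrite normrM ler_pM.
move: cov0 h3 h6 h7; rewrite /gibbs_cov !ler_norml.
move: (gibbs_E _) (gibbs_E _) (gibbs_E _) (gibbs_E _) (gibbs_E _) (gibbs_E _).
move=> a b c d e f; nra.
Qed.

End Cube.

(** * Comparison with product measures *)

Section Averaging.
Variables (R : realType) (I : finType) (a : R).
Hypothesis a01 : 0 <= a <= 1.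
Implicit Types (y z : {ffun I -> bool}) (e : I) (F g : {ffun I -> bool} -> R).

Definition avg1 e F y : R := (1 - a) * F (put y e false) + a * F (put y e true).

(** Resampling of the coordinates in [s] as independent Bernoulli([a]) variables, the others kept.
    For [s = enum I] this is the expectation under the product measure, still written as a function
    of [y]. *)
Fixpoint avg (s : seq I) F : {ffun I -> bool} -> R :=
  if s is e :: s' then avg s' (avg1 e F) else F.

Lemma le_avg1 e F g : (forall y, F y <= g y) ->
  forall y, avg1 e F y <= avg1 e g y.
Proof.
case/andP: a01 => a0 a1 h y.
by rewrite lerD // ler_wpM2l // subr_ge0.
Qed.

Lemma le_avg (s : seq I) F g : (forall y, F y <= g y) ->
  forall y, avg s F y <= avg s g y.
Proof. by elim: s F g => [|e s IH] F g h //=; apply/IH/le_avg1. Qed.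

Lemma eq_avg (s : seq I) F g : F =1 g -> avg s F =1 avg s g.
Proof.
move=> h y; apply/eqP; rewrite eq_le; apply/andP.
by split; apply: le_avg => z; rewrite h.
Qed.

Lemma avg_affine (s : seq I) F (b c : R) y :
  avg s (fun z => b + c * F z) y = b + c * avg s F y.
Proof.
elim: s F => [|e s IH] F //=; rewrite -IH; apply: eq_avg => z.
by rewrite /avg1; ring.
Qed.

Lemma avgZ (s : seq I) F (c : R) y : avg s (fun z => c * F z) y = c * avg s F y.
Proof.
by rewrite -[RHS]add0r -avg_affine; apply: eq_avg => z; rewrite add0r.
Qed.

Lemma avg_sum (s : seq I) (J : finType) (F : J -> {ffun I -> bool} -> R) y :
  avg s (fun z => \sum_j F j z) y = \sum_j avg s (F j) y.
Proof.
elim: s F => [|e s IH] F //=; rewrite -IH; apply: eq_avg => z.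
by rewrite /avg1 !mulr_sumr -big_split.
Qed.

Lemma disc_avg1 e e' F y :
  disc e (avg1 e' F) y = if e == e' then 0 else avg1 e' (disc e F) y.
Proof.
rewrite /disc /avg1; case: eqP => [->|/eqP ne]; first by rewrite !put_put subrr.
by rewrite !(put_comm _ _ _ ne); ring.
Qed.

(** Taking [sg] to be 1 or -1 treats increasing and decreasing functions together here and below. *)
Lemma disc_avg1_bound (sg : R) (c : I -> R) e' F :
  (forall e y, 0 <= sg * disc e F y <= c e) ->
  forall e y, 0 <= sg * disc e (avg1 e' F) y <= c e.
Proof.
move=> h e y; rewrite disc_avg1; case: ifP => _.
  by rewrite mulr0 lexx; case/andP: (h e y) => h1 h2; apply: le_trans h2.
case/andP: a01 => a0 a1.
case/andP: (h e (put y e' false)) => l0 u0.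
case/andP: (h e (put y e' true)) => l1 u1.
rewrite /avg1; set u := disc _ _ _ in l0 u0 *; set v := disc _ _ _ in l1 u1 *.
by apply/andP; split; nra.
Qed.

(** From exp(-x) >= 1 - x one gets exp(x) <= 1/(1 - x), and (1 + x + 2 x^2)(1 - x) = 1 + x^2 (1 - 2
    x) >= 1. No lower bound on [x] is required. *)
Lemma expR_le_quad (x : R) : x <= 2^-1 -> expR x <= 1 + x + 2 * x ^+ 2.
Proof.
move=> hx; have h1 : 0 < 1 - x by lra.
have h2 : expR x <= (1 - x)^-1.
  rewrite -[expR x]invrK lef_pV2 ?posrE ?invr_gt0 ?expR_gt0 //.
  by rewrite -expRN; apply: expR_ge1Dx.
apply: le_trans h2 _; rewrite -div1r ler_pdivrMr //.
have := sqr_ge0 x; nra.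
Qed.

(** Both values of [F] lie within [c] of their average, so [expR_le_quad] applies around it; the
    linear terms cancel in the average and the quadratic ones go back into the exponent. *)
Lemma avg1_expR (lam c : R) e F : 0 <= lam -> lam * c <= 2^-1 ->
  (forall y, `|disc e F y| <= c) ->
  forall y, avg1 e (fun z => expR (lam * F z)) y
    <= expR (lam * avg1 e F y + 2 * lam ^+ 2 * c ^+ 2).
Proof.
move=> lam0 lamc bF y; have := bF y.
rewrite /disc /avg1; case/andP: a01 => a0 a1.
set u := F _; set v := F _ => uv.
have c0 : 0 <= c := le_trans (normr_ge0 _) uv.
set m := (1 - a) * v + a * u.
have bnd (x : R) : `|x - m| <= c -> expR (lam * x) <=
    expR (lam * m) * (1 + lam * (x - m) + 2 * lam ^+ 2 * c ^+ 2).
  move=> xm; have -> : lam * x = lam * m + lam * (x - m) by ring.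
  rewrite expRD ler_wpM2l ?expR_ge0 //.
  have h : lam * (x - m) <= 2^-1.
    apply: le_trans _ lamc; rewrite ler_wpM2l //.
    by apply: le_trans _ xm; apply: ler_norm.
  apply: le_trans (expR_le_quad h) _; rewrite lerD2l exprMn -mulrA.
  rewrite ler_pM2l // ler_wpM2l ?sqr_ge0 //.
  by rewrite -real_normK ?num_real // ler_pXn2r ?nnegrE.
have hu : `|u - m| <= c.
  have -> : u - m = (1 - a) * (u - v) by rewrite /m; ring.
  rewrite normrM ger0_norm ?subr_ge0 //; apply: le_trans _ uv.
  by rewrite ler_piMl // lerBlDr lerDl.
have hv : `|v - m| <= c.
  have -> : v - m = - (a * (u - v)) by rewrite /m; ring.
  rewrite normrN normrM (ger0_norm a0); apply: le_trans _ uv.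
  by rewrite ler_piMl.
rewrite expRD; apply: (@le_trans _ _ (expR (lam * m) * (1 + 2 * lam ^+ 2 * c ^+ 2))).
  apply: (@le_trans _ _ ((1 - a) * (expR (lam * m) * (1 + lam * (v - m) + 2 * lam ^+ 2 * c ^+ 2))
     + a * (expR (lam * m) * (1 + lam * (u - m) + 2 * lam ^+ 2 * c ^+ 2)))).
    by apply: lerD; apply: ler_wpM2l; rewrite ?subr_ge0 ?bnd.
  by rewrite le_eqVlt; apply/orP; left; apply/eqP; rewrite /m; ring.
by rewrite ler_wpM2l ?expR_ge0 // expR_ge1Dx.
Qed.

(** The method of bounded differences. Averaging over one coordinate does not increase the influence
    of the others, so the one-coordinate bound can be iterated. *)
Lemma avg_expR (lam : R) (c : I -> R) (s : seq I) F : 0 <= lam ->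
  (forall e, lam * c e <= 2^-1) ->
  (forall e y, `|disc e F y| <= c e) ->
  forall y, avg s (fun z => expR (lam * F z)) y
    <= expR (lam * avg s F y + 2 * lam ^+ 2 * \sum_(e <- s) c e ^+ 2).
Proof.
move=> lam0 lamc; elim: s F => [|e s IH] F bF y /=.
  by rewrite big_nil mulr0 addr0.
apply: (@le_trans _ _ (avg s (fun z => expR (2 * lam ^+ 2 * c e ^+ 2) *
    expR (lam * avg1 e F z)) y)).
  apply: le_avg => z; rewrite -expRD addrC.
  by apply: avg1_expR.
rewrite avgZ big_cons mulrDr addrCA [leRHS]expRD ler_wpM2l ?expR_ge0 //.
apply: IH => e' z; rewrite disc_avg1; case: ifP => _.
  by rewrite normr0; apply: le_trans (bF e' z).
case/andP: a01 => a0 a1.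
have := bF e' (put z e false); have := bF e' (put z e true).
rewrite /avg1 !ler_norml => /andP[l1 u1] /andP[l0 u0].
by apply/andP; split; nra.
Qed.

End Averaging.

Section Transfer.
Variables (R : realType) (I : finType) (w : {ffun I -> bool} -> R).
Hypothesis w_gt0 : forall y, 0 < w y.
Implicit Types (y z : {ffun I -> bool}) (e : I) (F g q : {ffun I -> bool} -> R).
Local Notation E := (gibbs_E w).
Local Notation P := (gibbs_P w).
Local Notation sigma := (cond_prob w).

(* Lindeberg replacement: the coordinates are resampled one after another from
   a Bernoulli(a) law; monotonicity of [g] makes only the conditional
   probabilities on the wrong side of [a] count. *)
Lemma gibbs_le_avg (a sg : R) (c : I -> R) (s : seq I) g :
  0 <= a <= 1 -> `|sg| = 1 ->
  (forall e y, 0 <= sg * disc e g y <= c e) ->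
  E g <= E (avg a s g)
         + \sum_(e <- s) c e * P (fun y => 0 < sg * (sigma e y - a)).
Proof.
move=> a01 sg1; elim: s g => [|e s IH] g bg /=.
  by rewrite big_nil addr0.
rewrite big_cons addrCA.
set X := c e * _; suff key : E g <= X + E (avg1 a e g).
  by apply: le_trans key _; rewrite lerD2l; apply: IH; apply: disc_avg1_bound.
rewrite -lerBlDr -gibbs_EB {}/X.
have -> : E (fun y => g y - avg1 a e g y) = E (fun y => (sigma e y - a) * disc e g y).
  apply/eqP; rewrite -subr_eq0 -gibbs_EB; apply/eqP.
  rewrite -[RHS](gibbs_cond w_gt0 (e := e) (F := disc e g)); last first.
    by move=> y b; rewrite disc_put.
  apply: eq_gibbs_E => y; rewrite /avg1 /disc -{1}(put_id y e).
  by case: (y e); rewrite ?mulr1n ?mulr0n; ring.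
rewrite -gibbs_EZ; apply: le_gibbs_E => // y.
case/andP: (bg e y) => l u; case/andP: (cond_prob01 w_gt0 e y) => s0 s1.
case/andP: a01 => a0 a1.
have sg2 : sg * sg = 1 by rewrite -expr2 -real_normK ?num_real // sg1 expr1n.
have -> : (sigma e y - a) * disc e g y = (sg * (sigma e y - a)) * (sg * disc e g y).
  by rewrite mulrACA sg2 mul1r.
have : sg * (sigma e y - a) <= 1.
  apply: le_trans (ler_norm _) _; rewrite normrM sg1 mul1r ler_norml; lra.
case: ltP; rewrite ?mulr1n ?mulr0n; move: (sg * _) (sg * _) l u => x x' *; nra.
Qed.

Definition clamp (x : R) : R := Num.max 0 (Num.min 1 x).

Lemma clamp_mono (x x' : R) : x <= x' -> 0 <= clamp x' - clamp x <= x' - x.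
Proof.
rewrite /clamp => h; case: (leP 1 x) => h1; case: (leP 1 x') => h2;
  case: (leP (0 : R) 1) => h3; case: (leP 0 x) => h4; case: (leP 0 x') => h5;
  apply/andP; split; lra.
Qed.

(** The first term is a Chernoff bound under the product measure; the second is the cost of passing
    to it, the total influence of a smoothed indicator times the probability [S] that a conditional
    probability is on the wrong side of [a]. *)
Lemma concentration (a sg eps lam m S : R) (c : I -> R) q :
  0 <= a <= 1 -> `|sg| = 1 -> 0 < eps -> 0 <= lam ->
  (forall e, lam * c e <= 2^-1) ->
  (forall e y, 0 <= disc e q y <= c e) ->
  (forall y, sg * (avg a (enum I) q y - m) <= 0) ->
  (forall e, P (fun y => 0 < sg * (sigma e y - a)) <= S) ->
  P (fun y => 2 * eps <= sg * (q y - m))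
  <= expR (- (lam * eps) + 2 * lam ^+ 2 * \sum_e c e ^+ 2)
     + eps^-1 * (\sum_e c e) * S.
Proof.
move=> a01 sg1 eps0 lam0 lamc bq mq hS.
have sg2 : sg * sg = 1 by rewrite -expr2 -real_normK ?num_real // sg1 expr1n.
have c0 e : 0 <= c e.
  by case/andP: (bq e [ffun=> false]) => h1 h2; apply: le_trans h2.
have ei : 0 <= eps^-1 by rewrite invr_ge0 ltW.
(* The smoothed indicator: 1 where [sg * (q y - m)] is at least [2 * eps], 0 where it is at most
   [eps], with slope [eps^-1] in between. It is also dominated by an exponential, as Chernoff's
   argument needs. *)
pose g y := clamp (eps^-1 * (sg * (q y - m) - eps)).
have g_ge y : ((2 * eps <= sg * (q y - m))%R%:R : R) <= g y.
  rewrite /g /clamp; case: (leP (2 * eps)) => h; last by rewrite mulr0n le_max lexx.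
  have h1 : 1 <= eps^-1 * (sg * (q y - m) - eps).
    by rewrite mulrC ler_pdivlMr //; lra.
  by rewrite min_l // mulr1n le_max lexx orbT.
have g_le y : g y <= expR (lam * (sg * (q y - m) - eps)).
  rewrite /g /clamp; set x := sg * _ - eps.
  case: (leP 0 x) => hx.
    apply: (@le_trans _ _ 1); last by rewrite -expR0 ler_expR mulr_ge0.
    by rewrite ge_max ler01 ge_min lexx.
  rewrite max_l ?expR_ge0 // ge_min; apply/orP; right.
  by rewrite pmulr_rle0 ?invr_gt0 // ltW.
have bg e y : 0 <= sg * disc e g y <= eps^-1 * c e.
  case/andP: (bq e y); rewrite /disc /g.
  set u := q _; set v := q _ => uv1 uv2.
  have /orP[/eqP->|/eqP->] : (sg == 1) || (sg == -1).
  - by rewrite -eqf_sqr expr1n expr2 sg2.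
  - set X := eps^-1 * (1 * (u - m) - eps); set Y := eps^-1 * (1 * (v - m) - eps).
    have YX : Y <= X by rewrite ler_wpM2l //; lra.
    have /andP[h1 h2] := clamp_mono YX.
    have h3 : X - Y = eps^-1 * (u - v) by rewrite /X /Y; ring.
    have h4 : eps^-1 * (u - v) <= eps^-1 * c e by rewrite ler_wpM2l.
    by rewrite mul1r h1 /=; apply: le_trans h4; rewrite -h3.
  - set X := eps^-1 * (-1 * (u - m) - eps); set Y := eps^-1 * (-1 * (v - m) - eps).
    have XY : X <= Y by rewrite ler_wpM2l //; lra.
    have /andP[h1 h2] := clamp_mono XY.
    have h3 : Y - X = eps^-1 * (u - v) by rewrite /X /Y; ring.
    have h4 : eps^-1 * (u - v) <= eps^-1 * c e by rewrite ler_wpM2l.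
    by rewrite mulN1r opprB h1 /=; apply: le_trans h4; rewrite -h3.
apply: le_trans (le_gibbs_E w_gt0 g_ge) _.
apply: le_trans (gibbs_le_avg (enum I) a01 sg1 bg) _.
apply: lerD; last first.
  rewrite big_enum /= mulr_sumr mulr_suml; apply: ler_sum => e _.
  by rewrite ler_wpM2l // mulr_ge0.
set K := expR _; rewrite -(gibbs_E_cst w_gt0 K); apply: le_gibbs_E => // y.
have bsq e y' : `|disc e (fun z => sg * (q z - m)) y'| <= c e.
  case/andP: (bq e y') => h1 h2; rewrite /disc -mulrBr normrM sg1 mul1r.
  by rewrite opprB addrA subrK ger0_norm.
have g_le' z : g z <= expR (- (lam * eps)) * expR (lam * (sg * (q z - m))).
  by rewrite -expRD addrC -mulrBr; apply: g_le.
have h := @le_avg R I a a01 (enum I) _ _ g_le' y.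
apply: le_trans h _; rewrite (avgZ a01).
rewrite /K expRD ler_wpM2l ?expR_ge0 //.
apply: le_trans (avg_expR a01 (enum I) lam0 lamc bsq y) _.
rewrite big_enum /= ler_expR gerDr.
have -> : avg a (enum I) (fun z => sg * (q z - m)) y = sg * (avg a (enum I) q y - m).
  rewrite mulrBr -mulrN addrC -(avg_affine a01).
  by apply: (eq_avg a01) => z; ring.
by rewrite mulr_ge0_le0.
Qed.
End Transfer.

(** * Polynomials in the edge variables *)

Section Polynomials.
Variables (R : realType) (I : finType).
Implicit Types (y z : {ffun I -> bool}) (e : I) (B : {set I}).

Definition mono B y : R := \prod_(i in B) (y i)%:R.

Definition poly_of (T : finType) (u : T -> R) (A : T -> {set I}) y : R :=
  \sum_t u t * mono (A t) y.

Lemma monoE B y : mono B y = [forall i in B, y i]%:R.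
Proof.
rewrite /mono; case: (boolP [forall i in B, y i]) => [/forall_inP h|].
  by rewrite big1 // => i iB; rewrite h.
rewrite negb_forall_in => /exists_inP[i iB /negbTE yi].
by rewrite (bigD1 i) //= yi mul0r.
Qed.

Lemma mono01 B y : 0 <= mono B y <= 1.
Proof. by rewrite monoE; case: ([forall i in B, y i]); rewrite ?lexx ler01. Qed.

Lemma mono_le B y z : cle y z -> mono B y <= mono B z.
Proof.
move/cleP=> yz; rewrite !monoE ler_nat.
case: (boolP [forall i in B, y i]) => // /forall_inP h.
by rewrite lt0b; apply/forall_inP => i /h /yz.
Qed.

Lemma disc_mono e B y : disc e (mono B) y = (e \in B)%:R * mono (B :\ e) y.
Proof.
have off b : mono (B :\ e) (put y e b) = mono (B :\ e) y.
  apply: eq_bigr => i; rewrite !inE => /andP[ne _].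
  by rewrite putE (negbTE ne).
rewrite /disc; case: (boolP (e \in B)) => eB.
  have aux z : mono B z = (z e)%:R * mono (B :\ e) z by apply: big_setD1.
  by rewrite !aux !off !putE eqxx mul0r subr0.
have <- : B :\ e = B by apply/setP => i; rewrite !inE; case: eqP => // ->; rewrite (negbTE eB).
by rewrite !off subrr mul0r.
Qed.

(** If [y] contains [B], then the meet agrees with [z] on [B]; otherwise the monomial vanishes at
    [y] and monotonicity suffices. *)
Lemma mono_supermod B y z :
  mono B y + mono B z <= mono B (cjoin y z) + mono B (cmeet y z).
Proof.
have h1 : mono B y <= mono B (cjoin y z) by apply/mono_le/cjoin_gel.
have h2 : mono B z <= mono B (cjoin y z) by apply/mono_le/cjoin_ger.
case: (boolP [forall i in B, y i]) => [/forall_inP hy|ny]; last first.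
  rewrite {1}(monoE B y) (negbTE ny) add0r -[leLHS]addr0; apply: lerD => //.
  by case/andP: (mono01 B (cmeet y z)).
have -> : mono B (cmeet y z) = mono B z.
  by apply: eq_bigr => i iB; rewrite ffunE hy.
by rewrite lerD2r.
Qed.

Lemma mono_modular B y z : (#|B| <= 1)%N ->
  mono B y + mono B z = mono B (cjoin y z) + mono B (cmeet y z).
Proof.
case: (posnP #|B|) => [/cards0_eq -> _|B0 B1]; first by rewrite /mono !big_set0.
have /cards1P[i ->] : #|B| == 1%N by rewrite eqn_leq B1.
rewrite /mono !big_set1 !ffunE.
by case: (y i); case: (z i); rewrite /= ?addr0 ?add0r.
Qed.

Lemma avg_mono (a : R) (s : seq I) B y : 0 <= a <= 1 -> uniq s ->
  avg a s (mono B) y = \prod_(i in B) (if i \in s then a else (y i)%:R).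
Proof.
move=> a01; elim: s B y => [|e s IH] B y /=; first by [].
case/andP=> nes us.
have -> : avg a s (avg1 a e (mono B)) y
   = avg a s (fun z => (if e \in B then a else 1) * mono (B :\ e) z) y.
  apply: (eq_avg a01) => z.
  have off b : mono (B :\ e) (put z e b) = mono (B :\ e) z.
    apply: eq_bigr => i; rewrite !inE => /andP[ne _].
    by rewrite putE (negbTE ne).
  rewrite /avg1; case: (boolP (e \in B)) => eB.
    have aux x : mono B x = (x e)%:R * mono (B :\ e) x by apply: big_setD1.
    by rewrite !aux !off !putE eqxx mul0r mulr0 add0r mul1r.
  have {1 2}<- : B :\ e = B.
    by apply/setP => i; rewrite !inE; case: eqP => // ->; rewrite (negbTE eB).
  by rewrite !off; ring.
rewrite (avgZ a01) IH //; case: (boolP (e \in B)) => eB.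
  rewrite [RHS](big_setD1 e) //= inE eqxx; congr (_ * _).
  by apply: eq_bigr => i; rewrite !inE => /andP[/negbTE -> _].
rewrite mul1r; have -> : B :\ e = B.
  by apply/setP => i; rewrite !inE; case: eqP => // ->; rewrite (negbTE eB).
apply: eq_bigr => i iB; rewrite inE; case: eqP => // ie.
by move: eB; rewrite -ie iB.
Qed.

Lemma avg_mono_enum (a : R) B y : 0 <= a <= 1 ->
  avg a (enum I) (mono B) y = a ^+ #|B|.
Proof.
move=> a01; rewrite avg_mono ?enum_uniq // -prodr_const.
by apply: eq_bigr => i _; rewrite mem_enum.
Qed.

Section Poly.
Variables (T : finType) (u : T -> R) (A : T -> {set I}).

Lemma avg_poly (a : R) y : 0 <= a <= 1 ->
  avg a (enum I) (poly_of u A) y = \sum_t u t * a ^+ #|A t|.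
Proof.
move=> a01; rewrite (avg_sum a01); apply: eq_bigr => t _.
by rewrite (avgZ a01) avg_mono_enum.
Qed.

Lemma disc_poly e y : disc e (poly_of u A) y =
  poly_of (fun t => u t * (e \in A t)%:R) (fun t => A t :\ e) y.
Proof.
rewrite /disc /poly_of -sumrB; apply: eq_bigr => t _.
by rewrite -mulrBr -mulrA -disc_mono.
Qed.

Lemma poly_bounds y : (forall t, 0 <= u t) ->
  0 <= poly_of u A y <= \sum_t u t.
Proof.
move=> u0; apply/andP; split.
  by apply: sumr_ge0 => t _; rewrite mulr_ge0 //; case/andP: (mono01 (A t) y).
by apply: ler_sum => t _; rewrite ler_piMr //; case/andP: (mono01 (A t) y).
Qed.

End Poly.

Section AlmostPositive.
Variables (T : finType) (u : T -> R) (A : T -> {set I}).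

(** Negative coefficients are allowed only in degree at most one, where the monomials are modular
    and their second differences vanish. The single-edge term, whose parameter may have either sign,
    fits into this class. *)
Definition almost_pos := forall t, 0 <= u t \/ (#|A t| <= 1)%N.

(** The weighted number of monomials containing both [e] and [e'], which bounds the mixed second
    difference. Removing [e] from the set makes it vanish for [e = e']. *)
Definition codeg e e' : R := \sum_t u t * (e \in A t)%:R * (e' \in A t :\ e)%:R.

Lemma codeg_term_ge0 e e' t : almost_pos ->
  0 <= u t * (e \in A t)%:R * (e' \in A t :\ e)%:R.
Proof.
move=> /(_ t)[u0|A1]; first by rewrite !mulr_ge0.
case: (boolP (e \in A t)) => eA; last by rewrite mulr0 mul0r.
suff -> : A t :\ e = finset.set0 by rewrite inE mulr0.
by apply: cards0_eq; move: A1; rewrite (cardsD1 e) eA ltnS leqn0 => /eqP.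
Qed.

(** The mixed difference is a polynomial with nonnegative coefficients. Hence [disc e] of the
    polynomial is an increasing statistic with influences [codeg u A e], in the form that
    [concentration] expects. *)
Lemma disc_disc_poly e e' y : almost_pos ->
  0 <= disc e' (disc e (poly_of u A)) y <= codeg e e'.
Proof.
move=> ap.
set u' := fun t => u t * (e \in A t)%:R; set A' := fun t => A t :\ e.
have -> : disc e' (disc e (poly_of u A)) y = disc e' (poly_of u' A') y.
  by apply: eq_disc => z; apply: disc_poly.
rewrite disc_poly.
by apply: poly_bounds => t; apply: codeg_term_ge0.
Qed.

Lemma poly_supermod y z : almost_pos ->
  poly_of u A y + poly_of u A z <=
  poly_of u A (cjoin y z) + poly_of u A (cmeet y z).
Proof.
move=> ap; rewrite /poly_of -!big_split; apply: ler_sum => t _ /=.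
rewrite -!mulrDr; case: (ap t) => [u0|A1].
  by rewrite ler_wpM2l // mono_supermod.
by rewrite mono_modular.
Qed.

Lemma avg_disc_poly (a : R) e y : 0 <= a <= 1 ->
  avg a (enum I) (disc e (poly_of u A)) y =
  \sum_t u t * (e \in A t)%:R * a ^+ (#|A t| - 1).
Proof.
move=> a01; rewrite (eq_avg a01 _ (disc_poly u A e)) avg_poly //.
apply: eq_bigr => t _; case: (boolP (e \in A t)) => eA.
  by rewrite (cardsD1 e (A t)) eA add1n subn1.
by rewrite mulr0 !mul0r.
Qed.

End AlmostPositive.
End Polynomials.

(** * The logistic function *)

Section Logistic.
Variable R : realType.

Definition lgs (x : R) : R := expR x / (expR x + 1).

Lemma lgs01 x : 0 < lgs x < 1.
Proof.
have h := expR_gt0 x; have h' : 0 < expR x + 1 by lra.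
by rewrite divr_gt0 //= ltr_pdivrMr //; lra.
Qed.

(** The increment equals (1 - exp(x - x')) times the last product. Keeping that product, instead of
    the crude factor 1/4, retains the slope p (1 - p) near p on which the subcriticality condition
    depends. *)
Lemma lgs_diff (x x' : R) : x <= x' ->
  0 <= lgs x' - lgs x <= (x' - x) * (lgs x' * (1 - lgs x)).
Proof.
move=> xx'; have -> : lgs x' - lgs x = (1 - expR (x - x')) * (lgs x' * (1 - lgs x)).
  rewrite expRB /lgs; have := expR_gt0 x; have := expR_gt0 x'.
  move: (expR x) (expR x') => a b *.
  by field; rewrite ?lt0r_neq0 //; lra.
have /andP[h1 h2] := lgs01 x; have /andP[h3 h4] := lgs01 x'.
have h5 := expR_ge1Dx (x - x').
have h6 : expR (x - x') <= 1 by rewrite -expR0 ler_expR; lra.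
have h7 : 0 <= lgs x' * (1 - lgs x) by rewrite mulr_ge0 //; lra.
by rewrite mulr_ge0 ?ler_wpM2r //; lra.
Qed.

Lemma lgs_lip (sg d x x' : R) : `|sg| = 1 -> 0 <= d ->
  sg * (x' - x) <= d -> sg * (lgs x' - lgs x) <= d.
Proof.
move=> sg1 d0.
have sgE : (sg == 1) || (sg == -1).
  by rewrite -eqf_sqr expr1n -real_normK ?num_real // sg1 expr1n.
have aux (s t : R) : s <= t -> 0 <= lgs t - lgs s <= t - s.
  move=> st; have /andP[-> h] := lgs_diff st; apply: le_trans h _ => /=.
  have /andP[h1 h2] := lgs01 s; have /andP[h3 h4] := lgs01 t.
  rewrite ler_piMr; [by []|lra|].
  by apply: mulr_ile1; lra.
case: (leP x x') => [h|/ltW h]; have /andP[h1 h2] := aux _ _ h;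
  by case/orP: sgE => /eqP ->; lra.
Qed.

End Logistic.

(** * Concentration of the conditional edge probabilities *)

Section Concentration.
Variables (R : realType) (I T : finType) (u : T -> R) (A : T -> {set I}).
Hypothesis upos : almost_pos u A.
Local Notation f := (poly_of u A).
Local Notation w := (fun y : {ffun I -> bool} => expR (f y)).
Local Notation E := (gibbs_E w).
Local Notation P := (gibbs_P w).
Local Notation sigma := (cond_prob w).

Lemma w_gt0 y : 0 < w y. Proof. exact: expR_gt0. Qed.

Lemma w_supermod y z : w y * w z <= w (cjoin y z) * w (cmeet y z).
Proof. by rewrite -!expRD ler_expR; apply: poly_supermod. Qed.

Lemma sigmaE e y : sigma e y = lgs (disc e f y).
Proof.
rewrite /cond_prob /lgs /disc expRB.
have := expR_gt0 (f (put y e true)); have := expR_gt0 (f (put y e false)).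
move: (expR _) (expR _) => a b *; field.
by rewrite !lt0r_neq0 //; lra.
Qed.

(** Here [nn] stands for the number of vertices, [K / nn] bounds every influence and every
    mean-field error, and [M a] is the approximate mean of [disc e f] under Bernoulli([a]) edges, so
    that [lgs (M a)] is the mean-field map. *)
Variables (p theta K nn : R) (M : R -> R) (l : nat).
Hypotheses (p01 : 0 <= p <= 1) (th01 : 0 <= theta < 1) (K1 : 1 <= K).
Hypotheses (l_gt0 : (0 < l)%N) (l8 : l%:R ^+ 8 <= nn).
Hypothesis contraction : forall a sg, 0 <= a <= 1 -> `|sg| = 1 ->
  0 <= sg * (a - p) -> sg * (lgs (M a) - p) <= theta * (sg * (a - p)).
Hypothesis meanM : forall e a, 0 <= a <= 1 ->
  `|\sum_t u t * (e \in A t)%:R * a ^+ (#|A t| - 1) - M a| <= K / nn.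
Hypothesis codeg_max : forall e e', codeg u A e e' <= K / nn.
Hypothesis codeg_sum : forall e, \sum_e' codeg u A e e' <= K.

(* [l] plays the role of [nn ^ (1/8)], so that [eps] is of order [nn ^ (-1/4)]. *)
Definition eps : R := (l%:R ^+ 2)^-1.

(** The Chernoff bound for a deviation of order [eps]: its exponent [eps ^+ 2 * nn / (8 * K ^+ 2)]
    is at least the one written here, because [nn] is at least l^8. *)
Definition tau : R := expR (- (l%:R ^+ 4 / (8 * K ^+ 2))).

Lemma lR : 1 <= (l%:R : R). Proof. by rewrite ler1n. Qed.

Lemma nn_gt0 : 0 < nn.
Proof. by apply: lt_le_trans l8; rewrite exprn_gt0 // ltr0n. Qed.

Lemma eps_gt0 : 0 < eps.
Proof. by rewrite invr_gt0 exprn_gt0 // ltr0n. Qed.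

Lemma eps_le1 : eps <= 1.
Proof. by rewrite invf_le1 ?exprn_gt0 ?ltr0n // exprn_ege1 // lR. Qed.

Lemma Knn_le : K / nn <= K * eps.
Proof.
rewrite ler_wpM2l //; first by have := K1; lra.
rewrite /eps lef_pV2 ?posrE ?nn_gt0 ?exprn_gt0 ?ltr0n //.
by apply: le_trans _ l8; apply: ler_weXn2l; rewrite ?lR.
Qed.

Lemma concentration_eps (a sg ma S : R) (c : I -> R) q :
  0 <= a <= 1 -> `|sg| = 1 -> 0 <= S ->
  (forall e y, 0 <= disc e q y <= c e) ->
  (forall e, c e <= K / nn) -> \sum_e c e <= K ->
  (forall y, `|avg a (enum I) q y - ma| <= K / nn) ->
  (forall e, P (fun y => 0 < sg * (sigma e y - a)) <= S) ->
  P (fun y => (2 + K) * eps <= sg * (q y - ma)) <= tau + K / eps * S.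
Proof.
move=> a01 sg1 S0 bq cmax csum mq hS.
have sg2 : sg * sg = 1 by rewrite -expr2 -real_normK ?num_real // sg1 expr1n.
have K0 : 0 < K by have := K1; lra.
have e0 := eps_gt0; have e1 := eps_le1; have n0 := nn_gt0; have hK := Knn_le.
have c0 e : 0 <= c e.
  by case/andP: (bq e [ffun=> false]) => h1 h2; apply: le_trans h1 h2.
(* This value minimises - lam eps + 2 lam^2 K^2 / nn, where K^2 / nn bounds the sum of squared
   influences: the largest influence times their sum. *)
pose lam := eps * nn / (4 * K ^+ 2).
have lam0 : 0 <= lam by rewrite divr_ge0 ?mulr_ge0 // ltW.
have K2 : 0 < 4 * K ^+ 2 by rewrite mulr_gt0 ?exprn_gt0.
have lamc e : lam * c e <= 2^-1.
  apply: (@le_trans _ _ (lam * (K / nn))); first by rewrite ler_wpM2l.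
  have -> : lam * (K / nn) = eps / (4 * K).
    by rewrite /lam; field; rewrite !lt0r_neq0.
  by rewrite ler_pdivrMr ?mulr_gt0 //; have := K1; nra.
(* Shifting the centre absorbs the error in the mean; since K / nn <= K eps, this turns the
   threshold 2 eps into (2 + K) eps. *)
pose m := ma + sg * (K / nn).
have mq' y : sg * (avg a (enum I) q y - m) <= 0.
  have -> : sg * (avg a (enum I) q y - m)
      = sg * (avg a (enum I) q y - ma) - (sg * sg) * (K / nn) by rewrite /m; ring.
  rewrite sg2 mul1r subr_le0; apply: le_trans (ler_norm _) _.
  by rewrite normrM sg1 mul1r.
have := concentration w_gt0 a01 sg1 e0 lam0 lamc bq mq' hS.
have sub : P (fun y => (2 + K) * eps <= sg * (q y - ma))
    <= P (fun y => 2 * eps <= sg * (q y - m)).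
  apply: (le_gibbs_P w_gt0) => y h.
  have -> : sg * (q y - m) = sg * (q y - ma) - (sg * sg) * (K / nn) by rewrite /m; ring.
  by rewrite sg2; lra.
move/(le_trans sub)/le_trans; apply; apply: lerD.
  rewrite ler_expR.
  have hc : \sum_e c e ^+ 2 <= K ^+ 2 / nn.
    apply: (@le_trans _ _ (\sum_e (K / nn) * c e)).
      by apply: ler_sum => e _; rewrite expr2 ler_wpM2r.
    rewrite -mulr_sumr; apply: (@le_trans _ _ (K / nn * K)).
      by rewrite ler_wpM2l // divr_ge0 // ltW.
    by rewrite le_eqVlt; apply/orP; left; apply/eqP; ring.
  have h2 : 2 * lam ^+ 2 * \sum_e c e ^+ 2 <= 2 * lam ^+ 2 * (K ^+ 2 / nn).
    by rewrite ler_wpM2l // mulr_ge0 // sqr_ge0.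
  have h3 : - (lam * eps) + 2 * lam ^+ 2 * (K ^+ 2 / nn) = - (eps ^+ 2 * nn / (8 * K ^+ 2)).
    by rewrite /lam; field; rewrite !lt0r_neq0.
  apply: (@le_trans _ _ (- (eps ^+ 2 * nn / (8 * K ^+ 2)))).
    by rewrite -h3 lerD2l.
  rewrite lerN2; apply: ler_wpM2r; first by rewrite invr_ge0 mulr_ge0 // sqr_ge0.
  have l0 : (l%:R : R) != 0 by rewrite pnatr_eq0 -lt0n.
  have -> : (l%:R : R) ^+ 4 = eps ^+ 2 * l%:R ^+ 8 by rewrite /eps; field.
  by rewrite ler_wpM2l // sqr_ge0.
by rewrite [eps^-1 * _]mulrC ler_wpM2r // ler_wpM2r // invr_ge0 ltW.
Qed.

(** The fixed point of r = theta r + (2 + K): one step of the iteration contracts the distance to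
    [p] by [theta] and adds an error of (2 + K) eps. *)
Definition rate : R := (2 + K) / (1 - theta).

Definition radius (k : nat) : R := theta ^+ k + rate * eps.

Definition level (sg : R) k : R := clamp (p + sg * radius k).

Lemma rate_ge0 : 0 <= rate.
Proof. by case/andP: th01 => *; rewrite divr_ge0 //; have := K1; lra. Qed.

Lemma radius_ge0 k : 0 <= radius k.
Proof.
case/andP: th01 => *; rewrite addr_ge0 ?exprn_ge0 // mulr_ge0 ?rate_ge0 //.
by rewrite ltW ?eps_gt0.
Qed.

Lemma sign_cases (sg : R) : `|sg| = 1 -> sg = 1 \/ sg = -1.
Proof.
move=> sg1; have : (sg == 1) || (sg == -1).
  by rewrite -eqf_sqr expr1n -real_normK ?num_real // sg1 expr1n.
by case/orP => /eqP ->; [left|right].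
Qed.

Lemma clampP (x : R) : [\/ x <= 0 /\ clamp x = 0, 0 <= x <= 1 /\ clamp x = x |
  1 <= x /\ clamp x = 1].
Proof.
rewrite /clamp; case: (leP 1 x) => h1.
  by apply: Or33; rewrite max_r.
case: (leP 0 x) => h2; [apply: Or32|apply: Or31]; split=> //; last exact: ltW.
by rewrite ltW.
Qed.

Lemma level01 sg k : 0 <= level sg k <= 1.
Proof. by rewrite /level; case: (clampP (p + sg * radius k)) => -[h ->]; lra. Qed.

Lemma level_dev sg k : `|sg| = 1 -> 0 <= sg * (level sg k - p) <= radius k.
Proof.
move=> sg1; have h := radius_ge0 k; have /andP[p0 p1] := p01.
rewrite /level; case: (clampP (p + sg * radius k)) => -[+ ->];
  by case: (sign_cases sg1) => ->; lra.
Qed.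

Lemma level_above sg k (s : R) : `|sg| = 1 -> 0 <= s <= 1 ->
  sg * (s - p) <= radius k -> sg * (s - level sg k) <= 0.
Proof.
move=> sg1 s01; rewrite /level; case: (clampP (p + sg * radius k)) => -[+ ->];
  by case: (sign_cases sg1) => ->; lra.
Qed.

Lemma tau_ge0 : 0 <= tau. Proof. exact: expR_ge0. Qed.

Lemma Keps_ge0 : 0 <= K / eps.
Proof. by rewrite divr_ge0 //; [have := K1; lra|rewrite ltW ?eps_gt0]. Qed.

(* Starting from the trivial bounds [0 <= sigma <= 1], each step applies the
   mean-field map [lgs \o M], up to an error [O(eps)]. *)
Lemma sigma_level sg k e : `|sg| = 1 ->
  P (fun y => 0 < sg * (sigma e y - level sg k)) <= tau * (1 + K / eps) ^+ k.
Proof.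
move=> sg1; have t0 := tau_ge0; have k0 := Keps_ge0.
elim: k e => [|k IH] e.
  rewrite expr0 mulr1; apply: le_trans t0.
  rewrite -[leRHS](gibbs_E_cst w_gt0 0); apply: (le_gibbs_E w_gt0) => y /=.
  suff -> : (0 < sg * (sigma e y - level sg 0)) = false by [].
  apply/negbTE; rewrite -leNgt; apply: level_above => //.
    exact: (cond_prob01 w_gt0).
  have /andP[s0 s1] := cond_prob01 w_gt0 e y; have /andP[p0 p1] := p01.
  have h : 0 <= rate * eps by rewrite mulr_ge0 ?rate_ge0 // ltW ?eps_gt0.
  by rewrite /radius expr0; case: (sign_cases sg1) => ->; lra.
set a := level sg k.
have a01 : 0 <= a <= 1 by apply: level01.
have S0 : 0 <= tau * (1 + K / eps) ^+ k by rewrite mulr_ge0 // exprn_ge0 //; lra.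
have := @concentration_eps a sg (M a) _ (codeg u A e) (disc e f) a01 sg1 S0.
move=> /(_ (fun e' y => disc_disc_poly e e' y upos) (codeg_max e) (codeg_sum e)).
move=> /(_ (fun y => _) IH).
rewrite -/a => h.
(* The fresh Chernoff term is absorbed because (1 + K / eps)^k is at least 1. *)
apply: (@le_trans _ _ (tau + K / eps * (tau * (1 + K / eps) ^+ k))); last first.
  have : 1 <= (1 + K / eps) ^+ k by rewrite exprn_ege1 //; lra.
  by rewrite exprS; nra.
apply: le_trans (h _); last first.
  by move=> y; rewrite avg_disc_poly //; apply: meanM.
apply: (le_gibbs_P w_gt0) => y; rewrite ltNge; apply: contraR; rewrite -ltNge => lt.
(* By contraposition: if [disc e f] does not deviate from [M a], then [sigma] stays within the next
   level, since [lgs] is 1-Lipschitz and the mean-field map contracts. *)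
apply: level_above => //; first exact: (cond_prob01 w_gt0).
have /andP[d0 d1] := level_dev k sg1.
have c := contraction a01 sg1 d0.
have h1 : sg * (lgs (disc e f y) - lgs (M a)) <= (2 + K) * eps.
  apply: lgs_lip => //; last exact: ltW.
  by rewrite mulr_ge0 //; [have := K1; lra|rewrite ltW ?eps_gt0].
have th0 : 0 <= theta by case/andP: th01.
have h2 : theta * (sg * (a - p)) <= theta * radius k by rewrite ler_wpM2l.
have h3 : radius k.+1 = theta * radius k + (2 + K) * eps.
  rewrite /radius /rate exprS; field.
  by rewrite subr_eq0 eq_sym lt_eqF //; case/andP: th01.
rewrite sigmaE h3; move: h1 h2 c; lra.
Qed.

Section Tail.
Variable k : nat.
Hypothesis hk : theta ^+ k <= eps.

Lemma radius_le : radius k <= (1 + rate) * eps.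
Proof. by rewrite /radius mulrDl mul1r lerD2r. Qed.

(** The exponent is [k.+1] because [stat_tail] spends one more comparison after the [k] steps of the
    iteration. *)
Definition tail_bound : R := tau * (1 + K / eps) ^+ k.+1.

Lemma sigma_tail sg e : `|sg| = 1 ->
  P (fun y => (1 + rate) * eps < sg * (sigma e y - p)) <= tail_bound.
Proof.
move=> sg1; apply: le_trans (_ : tau * (1 + K / eps) ^+ k <= _); last first.
  rewrite ler_wpM2l ?tau_ge0 // ler_weXn2l //.
  by have := Keps_ge0; lra.
apply: le_trans (sigma_level k e sg1).
apply: (le_gibbs_P w_gt0) => y h.
have := level_dev k sg1; have := radius_le; move: h.
by case: (sign_cases sg1) => ->; lra.
Qed.

(** One more comparison, now for an arbitrary increasing statistic with small influences. The
    summand [K * (1 + rate)] pays for moving the centre from the current level to [p]. *)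
Lemma stat_tail sg (c : I -> R) q (Mq : R -> R) : `|sg| = 1 ->
  (forall e y, 0 <= disc e q y <= c e) ->
  (forall e, c e <= K / nn) -> \sum_e c e <= K ->
  (forall a y, 0 <= a <= 1 -> `|avg a (enum I) q y - Mq a| <= K / nn) ->
  (forall a, 0 <= a <= 1 -> `|Mq a - Mq p| <= K * `|a - p|) ->
  P (fun y => (2 + K + K * (1 + rate)) * eps < sg * (q y - Mq p)) <= tail_bound.
Proof.
move=> sg1 bq cmax csum mq lipq.
have t0 := tau_ge0; have k0 := Keps_ge0.
have a01 := level01 sg k.
have S0 : 0 <= tau * (1 + K / eps) ^+ k by rewrite mulr_ge0 // exprn_ge0 //; lra.
have := @concentration_eps (level sg k) sg (Mq (level sg k)) _ c q a01 sg1 S0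
  bq cmax csum (fun y => mq _ y a01) (fun e => sigma_level k e sg1).
set a := level sg k => h.
apply: (@le_trans _ _ (tau + K / eps * (tau * (1 + K / eps) ^+ k))); last first.
  have : 1 <= (1 + K / eps) ^+ k by rewrite exprn_ege1 //; lra.
  by rewrite /tail_bound exprS; nra.
apply: le_trans h; apply: (le_gibbs_P w_gt0) => y hy.
have d : `|a - p| <= (1 + rate) * eps.
  apply: le_trans radius_le; have := level_dev k sg1; rewrite -/a ler_norml.
  by case: (sign_cases sg1) => ->; lra.
have : sg * (Mq a - Mq p) <= K * ((1 + rate) * eps).
  apply: le_trans (ler_norm _) _; rewrite normrM sg1 mul1r.
  apply: le_trans (lipq _ a01) _; rewrite ler_wpM2l //; have := K1; lra.
move: hy; nra.
Qed.

End Tail.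
End Concentration.

(** * Superpolynomial decay of the tail after sufficiently many iterations *)

Section TailBound.
Variables (R : realType) (theta K : R).
Hypotheses (th01 : 0 <= theta < 1) (K1 : 1 <= K).

(** Geometric decay is weakened to a bound of order 1/k, which avoids logarithms and covers
    [theta = 0]. A number of iterations of order l^2 is affordable, so nothing is lost. *)
Lemma exp_geom (k : nat) : theta ^+ k * (1 + k%:R * (1 - theta)) <= 1.
Proof.
case/andP: th01 => t0 t1.
elim: k => [|k IH]; first by rewrite expr0; lra.
apply: le_trans IH; rewrite exprS -mulrA mulrCA ler_wpM2l ?exprn_ge0 //.
rewrite -subr_ge0 -natr1.
have -> : 1 + k%:R * (1 - theta) - theta * (1 + (k%:R + 1) * (1 - theta))
   = (k%:R + 1) * (1 - theta) ^+ 2 by ring.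
by rewrite mulr_ge0 ?sqr_ge0 // addr_ge0.
Qed.

Lemma nat_le_expR (n : nat) : n%:R <= expR (n%:R : R).
Proof. by apply: le_trans (expR_ge1Dx _); lra. Qed.

Lemma tail_bound_decay : exists C : R, forall l : nat, (0 < l)%N ->
  exists k, theta ^+ k <= eps R l /\ tail_bound K l k * l%:R ^+ 64 <= C.
Proof.
case/andP: (th01) => t0 t1.
pose m := Num.bound (1 - theta)^-1.
have hm : 1 <= m%:R * (1 - theta).
  rewrite -ler_pdivrMr ?subr_gt0 // mul1r ltW //.
  by apply: archi_boundP; rewrite invr_ge0; lra.
have K0 : 0 < K by have := K1; lra.
pose c := (8 * K ^+ 2)^-1.
have c0 : 0 < c by rewrite invr_gt0 mulr_gt0 // exprn_gt0.
pose D := (m.+1)%:R * (K + 2) + 64.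
have D0 : 0 < D by rewrite ltr_wpDl // mulr_ge0 //; lra.
(* The losses of the m l^2 + 1 comparisons and the factor l^64 together cost at most exp(D l^3),
   against the gain exp(- c l^4). The exponent l^3 (D - c l) is nonpositive for l >= D / c and at
   most D (D / c)^3 below that. *)
exists (expR (D * (D / c) ^+ 3)) => l l0; exists (m * l ^ 2)%N.
have lR1 : 1 <= (l%:R : R) by rewrite ler1n.
have l2 : 1 <= (l%:R : R) ^+ 2 by rewrite exprn_ege1.
have l23 : (l%:R : R) ^+ 2 <= l%:R ^+ 3 by rewrite ler_weXn2l.
have l13 : (l%:R : R) <= l%:R ^+ 3 by rewrite -{1}[l%:R]expr1 ler_weXn2l.
split.
  have := exp_geom (m * l ^ 2).
  have : l%:R ^+ 2 <= 1 + (m * l ^ 2)%:R * (1 - theta).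
    by rewrite natrM natrX; nra.
  have := exprn_ge0 (m * l ^ 2) t0.
  move=> x0 h1 h2.
  rewrite /eps -[leRHS]mul1r ler_pdivlMr ?exprn_gt0 ?ltr0n //.
  by move: (theta ^+ _) x0 h1 h2 => x *; nra.
rewrite /tail_bound /tau /eps invrK.
have h1 : 1 + K * l%:R ^+ 2 <= expR (K + 2 * l%:R).
  apply: (@le_trans _ _ ((1 + K) * l%:R ^+ 2)); first by nra.
  rewrite expRD; apply: ler_pM; rewrite ?expR_ge1Dx ?exprn_ge0 //; first by lra.
  by rewrite mulrC expRM_natr ler_pXn2r ?nnegrE ?expR_ge0 // nat_le_expR.
have h2 : (1 + K * l%:R ^+ 2) ^+ (m * l ^ 2).+1
    <= expR ((m.+1)%:R * (K + 2) * l%:R ^+ 3).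
  apply: (@le_trans _ _ (expR (K + 2 * l%:R) ^+ (m * l ^ 2).+1)).
    rewrite ler_pXn2r ?nnegrE ?expR_ge0 //.
    by rewrite addr_ge0 // mulr_ge0 ?exprn_ge0 // ltW.
  rewrite -expRM_natr ler_expR.
  have h : ((m * l ^ 2).+1)%:R <= (m.+1)%:R * l%:R ^+ 2 :> R.
    by rewrite -[(m * l ^ 2).+1%:R]natr1 -[m.+1%:R]natr1 natrM natrX mulrDl mul1r lerD2l.
  apply: (@le_trans _ _ ((K + 2 * l%:R) * ((m.+1)%:R * l%:R ^+ 2))).
    by rewrite ler_wpM2l //; lra.
  have -> : (m.+1)%:R * (K + 2) * l%:R ^+ 3 = ((K + 2) * l%:R) * ((m.+1)%:R * l%:R ^+ 2) :> R.
    by ring.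
  by rewrite ler_wpM2r ?mulr_ge0 ?exprn_ge0 //; nra.
have h3 : (l%:R : R) ^+ 64 <= expR (64 * l%:R ^+ 3).
  rewrite mulrC expRM_natr ler_pXn2r ?nnegrE ?expR_ge0 //.
  by apply: le_trans (nat_le_expR l) _; rewrite ler_expR.
apply: (@le_trans _ _ (expR (- (l%:R ^+ 4 / (8 * K ^+ 2))) *
    expR ((m.+1)%:R * (K + 2) * l%:R ^+ 3) * expR (64 * l%:R ^+ 3))).
  apply: ler_pM => //; rewrite ?exprn_ge0 ?mulr_ge0 ?expR_ge0 ?exprn_ge0 //.
    by rewrite addr_ge0 // mulr_ge0 ?exprn_ge0 // ltW.
  by rewrite ler_wpM2l ?expR_ge0.
rewrite -!expRD ler_expR.
have -> : - (l%:R ^+ 4 / (8 * K ^+ 2)) + (m.+1)%:R * (K + 2) * l%:R ^+ 3 + 64 * l%:R ^+ 3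
   = l%:R ^+ 3 * (D - c * l%:R) :> R by rewrite /D /c; ring.
have Dc : 0 < D / c by rewrite divr_gt0.
case: (leP (D / c) l%:R) => [|/ltW] h.
  apply: (@le_trans _ _ 0); last by rewrite mulr_ge0 ?exprn_ge0 ?(ltW Dc) ?(ltW D0).
  rewrite pmulr_rle0 ?exprn_gt0 ?ltr0n // subr_le0.
  by move: h; rewrite ler_pdivrMr // mulrC.
rewrite mulrC; apply: ler_pM; rewrite ?exprn_ge0 //.
- by rewrite subr_ge0 mulrC -ler_pdivlMr.
- by rewrite lerBlDr lerDl mulr_ge0 // (ltW c0).
by rewrite ler_pXn2r ?nnegrE ?(ltW Dc).
Qed.

End TailBound.

(** * Variance bounds from association *)

Section Paths.
Variables (R : realType) (I : finType).
Implicit Types (y z : {ffun I -> bool}) (e : I).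

(** The missing coordinates are switched on one at a time. Derivatives are controlled only between
    [y] and [z], which is all that the variance bounds can provide. *)
Lemma le_of_disc (F : {ffun I -> bool} -> R) y z : cle y z ->
  (forall x e, cle y x -> cle x z -> 0 <= disc e F x) -> F y <= F z.
Proof.
have [n] := ubnP #|[set i | z i && ~~ y i]|.
elim: n y => // n IH y; rewrite ltnS => hn yz h.
case: (pickP (fun i => z i && ~~ y i)) => [i /andP[zi yi]|no]; last first.
  suff -> : y = z by [].
  apply/ffunP => i; have := no i; have /cleP/(_ i) := yz.
  by case: (y i) (z i) => [] [] // /(_ isT).
pose y' := put y i true.
have yy' : cle y y' by case/andP: (put_le y i).
have y'z : cle y' z.
  apply/cleP => j; rewrite putE; case: eqP => [->//|_]; exact/cleP.
have yf : put y i false = y by rewrite -{2}(put_id y i) (negbTE yi).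
apply: (@le_trans _ _ (F y')).
  by have := h y i (cle_refl y) yz; rewrite /disc yf subr_ge0.
apply: IH => // [|x e y'x xz]; last by apply: h => //; apply: cle_trans y'x.
apply: leq_trans hn; apply: proper_card; apply/properP; split.
  apply/fintype.subsetP => j; rewrite !inE putE => /andP[->].
  by case: eqP => //=.
by exists i; rewrite !inE ?zi ?yi // putE eqxx andbF.
Qed.

(** Transfers a derivative bound from an endpoint of a monotone path to every configuration on it,
    typical or not. *)
Lemma disc_poly_le (T : finType) (u : T -> R) (A : T -> {set I}) e y z :
  almost_pos u A -> cle y z ->
  disc e (poly_of u A) y <= disc e (poly_of u A) z.
Proof.
move=> ap yz; apply: le_of_disc => // x e' _ _.
by case/andP: (disc_disc_poly e e' x ap).
Qed.

Definition edge_count y : R := \sum_i (y i)%:R.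

Lemma disc_edge_count e y : disc e edge_count y = 1.
Proof.
rewrite /disc /edge_count -sumrB (bigD1 e) //= !putE eqxx subr0 big1 ?addr0 //.
by move=> i ne; rewrite !putE (negbTE ne) subrr.
Qed.

Lemma edge_count_bound y : 0 <= edge_count y <= #|I|%:R.
Proof.
apply/andP; split; first exact: sumr_ge0.
rewrite -sum1_card natr_sum; apply: ler_sum => i _.
by rewrite ler_nat; case: (y i).
Qed.

End Paths.

Section Variance.
Variables (R : realType) (I T : finType) (u : T -> R) (A : T -> {set I}).
Hypothesis upos : almost_pos u A.
Local Notation f := (poly_of u A).
Local Notation w := (fun y : {ffun I -> bool} => expR (f y)).
Local Notation E := (gibbs_E w).
Local Notation P := (gibbs_P w).
Local Notation cov := (gibbs_cov w).
Local Notation sigma := (cond_prob w).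
Local Notation Y := (@edge_count R I).
Let wpos := w_gt0 u A.
Let wsup := w_supermod upos.

Lemma gibbs_covBr F g h :
  cov F (fun y => g y - h y) = cov F g - cov F h.
Proof.
rewrite /gibbs_cov gibbs_EB.
have -> : E (fun y => F y * (g y - h y)) = E (fun y => F y * g y) - E (fun y => F y * h y).
  by rewrite -gibbs_EB; apply: eq_gibbs_E => y; rewrite mulrBr.
by ring.
Qed.

Lemma gibbs_covDl F g h :
  cov (fun y => F y + g y) h = cov F h + cov g h.
Proof.
rewrite /gibbs_cov gibbs_ED.
have -> : E (fun y => (F y + g y) * h y) = E (fun y => F y * h y) + E (fun y => g y * h y).
  by rewrite -gibbs_ED; apply: eq_gibbs_E => y; rewrite mulrDl.
by ring.
Qed.

Lemma gibbs_covZl (c : R) F h : cov (fun y => c * F y) h = c * cov F h.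
Proof.
rewrite /gibbs_cov gibbs_EZ mulrBr mulrA; congr (_ - _).
by rewrite -gibbs_EZ; apply: eq_gibbs_E => y; rewrite mulrA.
Qed.

Lemma gibbs_covC F h : cov F h = cov h F.
Proof.
rewrite /gibbs_cov [_ * E h]mulrC; congr (_ - _).
by apply: eq_gibbs_E => y; rewrite mulrC.
Qed.

Lemma gibbs_covZr (c : R) F h : cov F (fun y => c * h y) = c * cov F h.
Proof. by rewrite gibbs_covC gibbs_covZl gibbs_covC. Qed.

(** The sum of the log-odds of the conditional edge probabilities. It replaces their sum in
    monotonicity arguments because it is again an almost positive polynomial, indexed by a monomial
    and a removed edge. *)
Definition laplacian y : R := \sum_e disc e f y.

Definition lap_coeff (te : T * I) : R := u te.1 * (te.2 \in A te.1)%:R.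

Definition lap_set (te : T * I) : {set I} := A te.1 :\ te.2.

Lemma laplacianE : laplacian =1 poly_of lap_coeff lap_set.
Proof.
move=> y; rewrite /laplacian /poly_of.
under eq_bigr do rewrite disc_poly.
by rewrite exchange_big pair_big.
Qed.

Lemma lap_pos : almost_pos lap_coeff lap_set.
Proof.
move=> [t e]; case: (upos t) => h; [left|right]; first by rewrite mulr_ge0.
by apply: leq_trans h; apply/subset_leq_card/subD1set.
Qed.

Lemma disc_disc_laplacian e e' y :
  0 <= disc e' (disc e laplacian) y <= codeg lap_coeff lap_set e e'.
Proof.
have := disc_disc_poly e e' y lap_pos.
suff -> : disc e' (disc e laplacian) y = disc e' (disc e (poly_of lap_coeff lap_set)) y by [].
by apply: eq_disc => z; apply: eq_disc; apply: laplacianE.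
Qed.

(** Since Y minus its summand at [e] does not involve [e], it is orthogonal to [y e - sigma e y].
    What remains is [y e * (1 - sigma e y)], at most 1 for each edge. *)
Lemma cov_edge_sigma :
  cov Y (fun y => Y y - \sum_e sigma e y) <= #|I|%:R.
Proof.
have mean0 : E (fun y => Y y - \sum_e sigma e y) = 0.
  have -> : E (fun y => Y y - \sum_e sigma e y)
      = E (fun y => \sum_e (((y e)%:R - sigma e y) * 1)).
    apply: eq_gibbs_E => y; rewrite /edge_count -sumrB.
    by apply: eq_bigr => e _; rewrite mulr1.
  rewrite gibbs_E_sum big1 // => e _.
  exact: (gibbs_cond wpos).
rewrite /gibbs_cov mean0 mulr0 subr0.
have -> : E (fun y => Y y * (Y y - \sum_e sigma e y)) =
    E (fun y => \sum_e ((y e)%:R - sigma e y) * Y y).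
  apply: eq_gibbs_E => y; rewrite -mulr_suml mulrC; congr (_ * _).
  by rewrite /edge_count sumrB.
rewrite gibbs_E_sum -sum1_card natr_sum; apply: ler_sum => e _.
pose Z y := Y y - (y e)%:R.
have Zind y b : Z (put y e b) = Z y.
  have ZE x : Z x = \sum_(i | i != e) (x i)%:R.
    by rewrite /Z /edge_count (bigD1 e) //= addrAC subrr add0r.
  by rewrite !ZE; apply: eq_bigr => i ne; rewrite putE (negbTE ne).
have -> : E (fun y => ((y e)%:R - sigma e y) * Y y) =
   E (fun y => ((y e)%:R - sigma e y) * Z y) + E (fun y => ((y e)%:R - sigma e y) * (y e)%:R).
  by rewrite -gibbs_ED; apply: eq_gibbs_E => y; rewrite /Z; ring.
rewrite (gibbs_cond wpos) // add0r -(gibbs_E_cst wpos 1).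
apply: (le_gibbs_E wpos) => y; rewrite (gibbs_E_cst wpos).
have /andP[s0 s1] := cond_prob01 wpos e y.
by case: (y e); rewrite ?mulr0 ?ler01 // mulr1 gerBl.
Qed.

Lemma var_edge_count (G : pred {ffun I -> bool}) (p delta kappa b : R) :
  0 <= p <= 1 -> 0 <= delta -> 0 <= kappa ->
  (p + delta) * (1 - p + delta) * kappa < 1 ->
  (forall y e, G y -> `|sigma e y - p| <= delta) ->
  (forall y e, G y -> disc e laplacian y <= kappa) ->
  P (predC G) <= b ->
  (1 - (p + delta) * (1 - p + delta) * kappa) * cov Y Y
   <= #|I|%:R + 12 * #|I|%:R ^+ 2 * b.
Proof.
move=> /andP[p0 p1] d0 k0 rho1 hs hk hb.
set rho := _ * kappa in rho1 *.
pose L := (p + delta) * (1 - p + delta).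
have L0 : 0 <= L by rewrite mulr_ge0 //; lra.
have rho0 : 0 <= rho by rewrite mulr_ge0.
pose S y := \sum_e sigma e y.
have Sb y : 0 <= S y <= #|I|%:R.
  apply/andP; split.
    by apply: sumr_ge0 => e _; case/andP: (cond_prob01 wpos e y).
  rewrite -sum1_card natr_sum; apply: ler_sum => e _.
  by case/andP: (cond_prob01 wpos e y).
have incS : increasing_on G (fun y => rho * Y y - S y).
  move=> y z Gy Gz yz.
  (* In the product of [lgs_diff], the upper end [z] bounds the first factor by p + delta and the
     lower end [y] bounds the second by 1 - p + delta. *)
  have h1 : S z - S y <= L * (laplacian z - laplacian y).
    rewrite /S /laplacian -!sumrB mulr_sumr; apply: ler_sum => e _.
    rewrite !sigmaE; have hd := disc_poly_le e upos yz.
    have /andP[_ h] := lgs_diff hd; apply: le_trans h _.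
    rewrite mulrC ler_wpM2r ?subr_ge0 // -!sigmaE.
    have := hs y e Gy; have := hs z e Gz; rewrite !ler_norml.
    have /andP[s0 s1] := cond_prob01 wpos e y.
    have /andP[s2 s3] := cond_prob01 wpos e z.
    move=> /andP[_ h1] /andP[h2 _].
    by apply: ler_pM; lra.
  have h2 : kappa * Y y - laplacian y <= kappa * Y z - laplacian z.
    apply: (@le_of_disc _ _ (fun y => kappa * Y y - laplacian y)) => // x e yx xz.
    have -> : disc e (fun y => kappa * Y y - laplacian y) x
       = kappa * disc e Y x - disc e laplacian x by rewrite /disc; ring.
    rewrite disc_edge_count mulr1 subr_ge0.
    (* The intermediate [x] need not lie in [G]; the derivative there is at most its value at the
       upper end [z]. *)
    apply: le_trans (hk z e Gz); rewrite !(eq_disc _ _ laplacianE).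
    exact: disc_poly_le lap_pos xz.
  have h3 : L * (laplacian z - laplacian y) <= L * (kappa * Y z - kappa * Y y).
    by rewrite ler_wpM2l //; lra.
  rewrite /rho -/L; nra.
have incY : increasing_on G Y.
  by move=> y z _ _ yz; apply: le_of_disc => // x e _ _; rewrite disc_edge_count.
have bY y : `|Y y| <= #|I|%:R.
  by have /andP[h1 h2] := edge_count_bound R y; rewrite ger0_norm.
have bS y : `|rho * Y y - S y| <= 2 * #|I|%:R.
  have /andP[h1 h2] := edge_count_bound R y; have /andP[h3 h4] := Sb y.
  have h5 : 0 <= rho * Y y by rewrite mulr_ge0.
  have h6 : rho * Y y <= Y y by rewrite ler_piMl // ltW.
  by rewrite ler_norml; apply/andP; split; lra.
have := approx_association wpos wsup incY incS bY bS.
have := cov_edge_sigma; rewrite -/S !gibbs_covBr gibbs_covZr.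
have hb2 : 6 * #|I|%:R * (2 * #|I|%:R) * P (predC G) <= 6 * #|I|%:R * (2 * #|I|%:R) * b.
  by rewrite ler_wpM2l // !mulr_ge0.
move: hb2; move: (P _) (cov _ _) (cov _ _) => *; nra.
Qed.

Lemma var_poly (T' : finType) (v : T' -> R) (B : T' -> {set I})
    (G : pred {ffun I -> bool}) (c r D b : R) :
  almost_pos v B -> 0 <= c -> 0 <= r ->
  (forall y e, G y -> `|disc e (poly_of v B) y - c| <= r) ->
  (forall y, `|poly_of v B y| <= D) ->
  P (predC G) <= b ->
  cov (fun y => poly_of v B y - c * Y y) (fun y => poly_of v B y - c * Y y)
  <= r ^+ 2 * cov Y Y + 6 * (D + (c + r) * #|I|%:R) ^+ 2 * b.
Proof.
move=> vpos c0 r0 hG bD hb; pose X y := poly_of v B y - c * Y y.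
rewrite -/(cov X X).
pose F1 y := X y + r * Y y; pose F2 y := r * Y y - X y.
have inc1 : increasing_on G F1.
  move=> y z Gy Gz yz; apply: le_of_disc => // x e yx xz.
  have -> : disc e F1 x = disc e (poly_of v B) x + (r - c) * disc e Y x.
    by rewrite /disc /F1 /X; ring.
  rewrite disc_edge_count mulr1.
  (* The lower end [y] gives the lower bound on the derivative; for [F2] the upper end [z] gives the
     upper bound. *)
  have := disc_poly_le e vpos yx; have := hG y e Gy; rewrite ler_norml; lra.
have inc2 : increasing_on G F2.
  move=> y z Gy Gz yz; apply: le_of_disc => // x e yx xz.
  have -> : disc e F2 x = (r + c) * disc e Y x - disc e (poly_of v B) x.
    by rewrite /disc /F2 /X; ring.
  rewrite disc_edge_count mulr1.
  have := disc_poly_le e vpos xz; have := hG z e Gz; rewrite ler_norml; lra.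
have bX y (s : R) : `|s| = 1 -> `|s * X y + r * Y y| <= D + (c + r) * #|I|%:R.
  move=> s1; have -> : s * X y + r * Y y = s * poly_of v B y + (r - s * c) * Y y.
    by rewrite /X; ring.
  apply: le_trans (ler_normD _ _) _; apply: lerD.
    by rewrite normrM s1 mul1r.
  have /andP[h1 h2] := edge_count_bound R y.
  rewrite normrM (ger0_norm h1); apply: ler_pM => //.
  apply: le_trans (ler_normB _ _) _.
  by rewrite normrM s1 mul1r !ger0_norm // addrC.
have b1 y : `|F1 y| <= D + (c + r) * #|I|%:R.
  by have := bX y 1 (normr1 _); rewrite mul1r.
have b2 y : `|F2 y| <= D + (c + r) * #|I|%:R.
  by have := bX y (-1) (normrN1 _); rewrite mulN1r addrC.
have := approx_association wpos wsup inc1 inc2 b1 b2.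
set Q := D + _ in b1 b2 *.
have -> : cov F1 F2 = r ^+ 2 * cov Y Y - cov X X.
  have hF h : cov F1 h = cov X h + r * cov Y h.
    by rewrite -gibbs_covZl -gibbs_covDl.
  by rewrite /F2 gibbs_covBr gibbs_covZr !hF (gibbs_covC X Y); ring.
have hb2 : 6 * Q ^+ 2 * P (predC G) <= 6 * Q ^+ 2 * b.
  by rewrite ler_wpM2l // mulr_ge0 // sqr_ge0.
move: hb2; rewrite expr2 !mulrA; lra.
Qed.

End Variance.

(** * The mean-field map *)

Section MeanField.
Variable R : realType.
Local Open Scope classical_set_scope.

Lemma is_derive_lgs (x : R) : is_derive x 1 (@lgs R) (lgs x * (1 - lgs x)).
Proof.
have [ge [hge cge gex]] := (is_derive1_caratheodory expR x (expR x)).1 (is_derive_expR x).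
apply/is_derive1_caratheodory.
exists (fun z => ge z * ((expR x + 1)^-1 * (expR z + 1)^-1)); split.
- move=> z; rewrite /lgs.
  have := expR_gt0 z; have := expR_gt0 x => hx hz.
  have -> : ge z * ((expR x + 1)^-1 * (expR z + 1)^-1) * (z - x)
    = (ge z * (z - x)) * ((expR x + 1)^-1 * (expR z + 1)^-1) by ring.
  rewrite -hge; move: (expR x) (expR z) hx hz => a b a0 b0; field.
  by rewrite !lt0r_neq0 //; lra.
- apply: continuousM; first exact: cge.
  apply: continuousM; first exact: cst_continuous.
  apply: continuousV; first by rewrite lt0r_neq0 // addr_gt0 // expR_gt0.
  by apply: continuousD; [exact: continuous_expR|exact: cst_continuous].
- rewrite gex /lgs; have := expR_gt0 x; move: (expR x) => a a0; field.
  by rewrite lt0r_neq0 //; lra.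
Qed.

Lemma is_derive_lgs_poly (q : {poly R}) (x : R) :
  is_derive x 1 (fun a => lgs q.[a]) (lgs q.[x] * (1 - lgs q.[x]) * q^`().[x]).
Proof.
have [g [hg cg gx]] := (is_derive1_caratheodory _ _ _).1 (is_derive_lgs q.[x]).
have [h [hh ch hx]] := (is_derive1_caratheodory _ _ _).1 (is_derive_poly q x).
apply/is_derive1_caratheodory; exists (fun z => g q.[z] * h z); split.
- by move=> z; rewrite hg hh mulrA.
- apply: cvgM => //.
  apply: (@continuous_comp _ _ _ (horner q) g) => //.
  exact: continuous_horner.
- by rewrite gx hx.
Qed.

Variables (q : {poly R}) (p : R).
Hypotheses (p01 : 0 < p < 1) (fixp : lgs q.[p] = p).
Hypothesis uniq_fix : forall a, 0 < a < 1 -> lgs q.[a] = a -> p = a.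
Hypothesis slope : derive1 (fun a => lgs q.[a]) p < 1.

Lemma slopeE : p * (1 - p) * q^`().[p] < 1.
Proof.
have := slope; rewrite derive1E.
have [_ ->] := is_derive_lgs_poly q p.
by rewrite fixp.
Qed.

(** Let [g] be Caratheodory's continuous extension of the slope (lgs q(a) - p)/(a - p). It is below
    1 at p by subcriticality and at 0 and 1 because [lgs] takes values in (0,1). If it reached 1
    elsewhere, the intermediate value theorem between that point and the end of [0,1] on the same
    side of p would give a second fixed point. So its maximum over [0,1] is below 1. *)
Lemma mean_field_contraction : exists2 theta, 0 <= theta < 1 &
  forall a sg, 0 <= a <= 1 -> `|sg| = 1 ->
  0 <= sg * (a - p) -> sg * (lgs q.[a] - p) <= theta * (sg * (a - p)).
Proof.
have /andP[p0 p1] := p01.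
have [g [hg cg gp]] := (is_derive1_caratheodory _ _ _).1 (is_derive_lgs_poly q p).
have cphi (x : R) : {for x, continuous (fun a => lgs q.[a])}.
  apply/differentiable_continuous/derivable1_diffP.
  by have [] := is_derive_lgs_poly q x.
have gE z : z != p -> g z = (lgs q.[z] - p) / (z - p).
  by move=> zp; rewrite -{1}fixp hg mulfK // subr_eq0.
have cont_g : continuous g.
  move=> x; have [->//|xp] := eqVneq x p.
  have : (fun z => (lgs q.[z] - p) / (z - p)) z @[z --> x] --> g x.
    rewrite gE //; apply: cvgM.
      by apply: cvgB; [exact: cphi|exact: cvg_cst].
    apply: cvgV; first by rewrite subr_eq0.
    by apply: cvgB; [exact: cvg_id|exact: cvg_cst].
  apply: cvg_trans; apply: near_eq_cvg.
  have : nbhs x [set z | z != p] by apply: open_nbhs_nbhs; split => //; exact: open_neq.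
  by apply: filterS => z /= zp; rewrite gE.
have g_lt1 c : 0 <= c <= 1 -> g c < 1.
  move=> /andP[c0 c1]; rewrite ltNge; apply/negP => gc.
  have nofix d : 0 <= d <= 1 -> d != p -> g d <> 1.
    move=> /andP[d0 d1] dp gd.
    have fd : lgs q.[d] = d.
      by have := hg d; rewrite /= gd fixp mul1r; lra.
    have /andP[f0 f1] := lgs01 q.[d]; rewrite fd in f0 f1.
    by move: dp; rewrite (uniq_fix _ fd) ?eqxx // f0 f1.
  have /andP[u0 u1] := lgs01 q.[1].
  have /andP[v0 v1] := lgs01 q.[0].
  have g1 : g 1 < 1.
    rewrite gE; last by rewrite gt_eqF.
    by rewrite ltr_pdivrMr ?subr_gt0 //; lra.
  have g0 : g 0 < 1.
    rewrite gE; last by rewrite lt_eqF.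
    by rewrite sub0r invrN mulrN -mulNr ltr_pdivrMr //; lra.
  case: (ltgtP c p) => [cp|cp|cp].
  - have [||d] := @IVT R g 0 c 1 c0; first exact: continuous_subspaceT.
      by rewrite ge_min le_max gc (ltW g0) orbT.
    rewrite in_itv /= => /andP[d0 dc]; apply: nofix; last by rewrite lt_eqF //; lra.
    by apply/andP; split; lra.
  - have [||d] := @IVT R g c 1 1 c1; first exact: continuous_subspaceT.
      by rewrite ge_min le_max gc (ltW g1) orbT.
    rewrite in_itv /= => /andP[cd d1]; apply: nofix; last by rewrite gt_eqF //; lra.
    by apply/andP; split; lra.
  - have := slopeE; have := gp; rewrite fixp -cp => <-; lra.
have c01 : {within `[0, 1], continuous g} := continuous_subspaceT cont_g.
have [c + cmax] := @EVT_max R g 0 1 ler01 c01.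
rewrite in_itv /= => c_in.
exists (Num.max 0 (g c)).
  by rewrite le_max lexx /= gt_max ltr01 g_lt1.
move=> a sg a01 sg1 ha.
have := hg a; rewrite /= fixp => ->.
rewrite mulrCA ler_wpM2r // le_max cmax ?orbT //.
Qed.

End MeanField.

(** * Counting embeddings *)

Lemma ffact_le_exp (n N k : nat) : (n <= N)%N -> (n ^_ k <= N ^ k)%N.
Proof.
move=> nN; rewrite ffact_prod -[k in leqRHS]card_ord -prod_nat_const.
by apply: leq_prod => i _; apply: leq_trans nN; apply: leq_subr.
Qed.

Section Embeddings.
Variables (H : sgraph) (n : nat).
Implicit Types (f : {ffun H -> 'I_n}) (e : vpair n) (y : config n).

(** The potential edges covered by the image of [H]. They form the monomial attached to [f], which
    makes homomorphism counts polynomials in the edge variables. *)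
Definition eset f : {set vpair n} :=
  [set ij : vpair n | [exists x, exists z,
     [&& adj x z, f x == (val ij).1 & f z == (val ij).2]]].

Lemma esetP f e : reflect (exists x z, [/\ adj x z, f x = (val e).1 & f z = (val e).2])
  (e \in eset f).
Proof.
rewrite inE; apply: (iffP existsP) => [[x /existsP[z /and3P[a /eqP b /eqP c]]]|[x [z [a b c]]]].
  by exists x, z.
by exists x; apply/existsP; exists z; rewrite a b c !eqxx.
Qed.

Lemma eset_pair f x z : injective f -> adj x z ->
  exists2 e : vpair n, e \in eset f & val e = (f x, f z) \/ val e = (f z, f x).
Proof.
move=> fi xz; have ne : f x != f z.
  by apply/negP => /eqP/fi xe; move: xz; rewrite xe adj_irr.
case: (ltngtP (f x) (f z)) => [lt|lt|/val_inj eq]; last by rewrite eq eqxx in ne.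
  exists (Sub (f x, f z) lt); last by left.
  by apply/esetP; exists x, z.
exists (Sub (f z, f x) lt); last by right.
by apply/esetP; exists z, x; rewrite adj_sym.
Qed.

(** Taking preimages of the two endpoints is a bijection from the covered pairs onto the edges of
    [H]. *)
Lemma card_eset f : injective f -> #|eset f| = nedge H.
Proof.
move=> fi; pose pe e : {set H} := [set x | (f x == (val e).1) || (f x == (val e).2)].
have peE e x z : f x = (val e).1 -> f z = (val e).2 -> pe e = [set x; z].
  by move=> fx fz; apply/setP => w; rewrite !inE -fx -fz !(inj_eq fi).
have pe_inj : {in eset f &, injective pe}.
  move=> e e' /esetP[x [z [_ fx fz]]] /esetP[x' [z' [_ fx' fz']]].
  rewrite (peE _ _ _ fx fz) (peE _ _ _ fx' fz') => eqs.
  apply: val_inj; rewrite [LHS]surjective_pairing [RHS]surjective_pairing -fx -fz -fx' -fz'.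
  have lt := valP e; have lt' := valP e'; rewrite /= -fx -fz in lt; rewrite /= -fx' -fz' in lt'.
  have : x \in [set x'; z'] by rewrite -eqs !inE eqxx.
  have : z \in [set x'; z'] by rewrite -eqs !inE eqxx orbT.
  rewrite !inE => /orP[]/eqP ez /orP[]/eqP ex; subst x z => //.
  - by rewrite ltnn in lt.
  - by have := ltn_trans lt lt'; rewrite ltnn.
  - by rewrite ltnn in lt.
rewrite -(card_in_imset pe_inj) /nedge; congr #|pred_of_set _|.
apply/setP => B; apply/imsetP/imsetP => [[e /esetP[x [z [xz fx fz]]] ->]|[[x z] /= xz ->]].
  by exists (x, z); [rewrite inE|exact: peE fx fz].
move: xz; rewrite inE /= => xz.
have [e ein [ve|ve]] := eset_pair fi xz; exists e => //.
  by apply/esym/peE; rewrite ve.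
by rewrite finset.setUC; apply/esym/peE; rewrite ve.
Qed.

Lemma injhomE (R : realType) y : (#|injhom H (config_graph y)|%:R : R) =
  \sum_(f : {ffun H -> 'I_n}) (injectiveb f)%:R * mono R (eset f) y.
Proof.
rewrite -sum1_card natr_sum big_mkcond /=; apply: eq_bigr => f _.
rewrite inE monoE -natrM mulnb.
case: injectiveP => //= fi.
suff -> : [forall i in eset f, y i] =
    [forall x, forall x0, adj x x0 ==> @adj (config_graph y) (f x) (f x0)] by case: ifP.
apply/esym; case: (boolP [forall x, _]) => [h|/negP h]; apply/esym.
  apply/forall_inP => e /esetP[x [z [xz fx fz]]].
  move/forallP/(_ x)/forallP/(_ z)/implyP/(_ xz): h => /existsP[e' /andP[ye']].
  rewrite fx fz -surjective_pairing => /orP[/eqP/val_inj <- //|/eqP ve'].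
  have := valP e; have := valP e'; rewrite /= ve' /= => l1 l2.
  by have := ltn_trans l1 l2; rewrite ltnn.
apply/negbTE/negP => /forall_inP h'; apply: h.
apply/forallP => x; apply/forallP => z; apply/implyP => xz.
have [e ein ve] := eset_pair fi xz.
apply/existsP; exists e; rewrite h' //=.
by case: ve => ->; rewrite eqxx ?orbT.
Qed.

Definition degree e : nat := \sum_(f : {ffun H -> 'I_n} | injectiveb f) (e \in eset f).

Lemma degree_perm_le (pi : {perm 'I_n}) e e' :
  pi (val e).1 = (val e').1 -> pi (val e).2 = (val e').2 -> (degree e <= degree e')%N.
Proof.
move=> h1 h2; pose g f : {ffun H -> 'I_n} := [ffun x => pi (f x)].
pose g' f : {ffun H -> 'I_n} := [ffun x => (pi^-1)%g (f x)].
have gK : cancel g g' by move=> f; apply/ffunP => x; rewrite !ffunE permK.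
have gK' : cancel g' g by move=> f; apply/ffunP => x; rewrite !ffunE permKV.
rewrite /degree [leqRHS](reindex_inj (can_inj gK)) /=.
apply: eq_leq; apply: eq_big => [f|f _].
  apply/injectiveP/injectiveP => fi x z; last first.
    by move=> e1; apply: fi; rewrite !ffunE e1.
  by rewrite !ffunE => /perm_inj/fi.
congr nat_of_bool; apply/esetP/esetP => -[x [z [xz fx fz]]]; exists x, z; split => //.
- by rewrite ffunE fx.
- by rewrite ffunE fz.
- by apply: (@perm_inj _ pi); rewrite h1 -fx ffunE.
- by apply: (@perm_inj _ pi); rewrite h2 -fz ffunE.
Qed.

(** Permutations of the vertices act transitively on ordered pairs of distinct vertices and preserve
    the count. *)
Lemma degree_const e e' : degree e = degree e'.
Proof.
have two (a b c d : 'I_n) : a != b -> c != d ->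
    exists pi : {perm 'I_n}, pi a = c /\ pi b = d.
  move=> ab cd; exists (tperm a c * tperm (tperm a c b) d)%g.
  rewrite !permM tpermL; split; last by rewrite tpermL.
  apply: tpermD; last by rewrite eq_sym.
  by rewrite -{2}(tpermL a c) (inj_eq perm_inj) eq_sym.
have ne (x : vpair n) : (val x).1 != (val x).2.
  by have := valP x; rewrite -val_eqE ltn_neqAle => /andP[].
apply/eqP; rewrite eqn_leq; apply/andP; split.
  by have [pi [h1 h2]] := two _ _ _ _ (ne e) (ne e'); apply: degree_perm_le h1 h2.
by have [pi [h1 h2]] := two _ _ _ _ (ne e') (ne e); apply: degree_perm_le h1 h2.
Qed.

Lemma card_vpair : (#|vpair n| * 2 = n * n.-1)%N.
Proof.
rewrite card_sig -sum1_card big_mkcond /=.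
rewrite -(pair_big xpredT xpredT (fun i j : 'I_n => if (i < j)%N then 1%N else 0%N)) /=.
rewrite exchange_big /= (eq_bigr (fun j : 'I_n => nat_of_ord j)); last first.
  move=> j _; rewrite -big_mkcond /= sum1_card.
  have -> : #|[pred i : 'I_n | (i < j)%N]| = #|[set widen_ord (ltnW (ltn_ord j)) i | i : 'I_j]|.
    apply: eq_card => i; rewrite inE; apply/idP/imsetP => [ij|[i' _ ->]] /=; last exact: ltn_ord.
    by exists (Ordinal ij) => //; apply: val_inj.
  by rewrite card_imset ?card_ord // => i i' /(congr1 val) /= /val_inj.
rewrite -(big_mkord xpredT (fun j => j)) bin2_sum.
by rewrite mulnC -mul_bin_diag bin1.
Qed.

(** Double counting: the degrees sum to the number of injections times [nedge H], and all n(n-1)/2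
    of them are equal. *)
Lemma degreeE e : (2 <= nvert H)%N ->
  degree e = (2 * nedge H * (n - 2) ^_ (nvert H - 2))%N.
Proof.
move=> v2.
have tot : (\sum_(e' : vpair n) degree e' = nedge H * n ^_ (nvert H))%N.
  rewrite /degree exchange_big /= (eq_bigr (fun=> nedge H)); last first.
    by move=> f /injectiveP fi; rewrite -(card_eset fi) -sum1_card [RHS]big_mkcond;
      apply: eq_bigr => e' _; case: (_ \in _).
  rewrite sum_nat_const mulnC; congr (_ * _)%N.
  have := card_inj_ffuns H 'I_n; rewrite card_ord cardsE => <-.
  by apply: eq_card => f.
rewrite (eq_bigr (fun=> degree e)) in tot; last by move=> e' _; apply: degree_const.
rewrite sum_nat_const in tot.
have n2 : (1 < n)%N.
  have := valP e; move: (val e) => [[i hi] [j hj]] /= ij.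
  by apply: leq_ltn_trans (_ : j < n)%N => //; apply: leq_ltn_trans ij.
have := card_vpair; case: n v2 tot n2 => [|[|m]] // v2 tot _ cv.
case: (nvert H) v2 tot => [|[|v]] // _ tot.
rewrite !subSS !subn0; apply/eqP.
rewrite -(eqn_pmul2l (m := m.+2 * m.+1)) // -{1}[m.+1]/(m.+2.-1) -cv.
rewrite mulnAC tot !ffactnS /=; apply/eqP; rewrite cv /=; ring.
Qed.

Lemma degree_le e : (2 <= nvert H)%N ->
  (degree e <= 2 * nedge H * n ^ (nvert H - 2))%N.
Proof.
move=> v2; rewrite degreeE // leq_mul2l; apply/orP; right.
by apply: ffact_le_exp; apply: leq_subr.
Qed.

(** Two distinct edges span at least three vertices. Choosing preimages of three of them costs v^3
    and leaves v - 3 free values; the factor n^3 stands on the left to avoid the subtraction. *)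
Lemma codegree_le e e' : e != e' ->
  ((\sum_(f : {ffun H -> 'I_n}) ((e \in eset f) && (e' \in eset f))) * n ^ 3
     <= nvert H ^ 3 * n ^ nvert H)%N.
Proof.
move=> ne; set S := (\sum_(f : _) _)%N.
have [k [kin k1 k2]] : exists k, [/\ (k == (val e').1) || (k == (val e').2),
    k != (val e).1 & k != (val e).2].
  have lt := valP e; have lt' := valP e'; rewrite /= in lt lt'.
  case: (boolP ((val e').1 \in [:: (val e).1; (val e).2])) => [h1|]; last first.
    by rewrite !inE negb_or => /andP[h1 h2]; exists (val e').1; rewrite eqxx.
  case: (boolP ((val e').2 \in [:: (val e).1; (val e).2])) => [h2|]; last first.
    by rewrite !inE negb_or => /andP[h2 h3]; exists (val e').2; rewrite eqxx orbT.
  case/eqP: ne; apply: val_inj.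
  rewrite [LHS]surjective_pairing [RHS]surjective_pairing.
  move: h1 h2; rewrite !inE => /orP[/eqP h1|/eqP h1] /orP[/eqP h2|/eqP h2]; rewrite h1 h2 // in lt' *.
  - by rewrite ltnn in lt'.
  - by have := ltn_trans lt lt'; rewrite ltnn.
  - by rewrite ltnn in lt'.
pose Q f (t : H * H * H) := [&& t.1.1 != t.1.2, t.1.1 != t.2, t.1.2 != t.2,
  f t.1.1 == (val e).1, f t.1.2 == (val e).2 & f t.2 == k].
have hS : (S <= \sum_(f : {ffun H -> 'I_n}) \sum_(t : H * H * H) Q f t)%N.
  apply: leq_sum => f _; case: andP => // -[/esetP[x [z [xz fx fz]]] /esetP[x' [z' [xz' fx' fz']]]].
  have [w fw] : exists w, f w = k.
    by case/orP: kin => /eqP ->; [exists x'|exists z'].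
  rewrite (bigD1 (x, z, w)) //= /Q /= fx fz fw !eqxx !andbT.
  have -> : x != z by apply/eqP => h; move: xz; rewrite h adj_irr.
  have -> : x != w by apply/eqP => h; move: k1; rewrite -fx -fw h eqxx.
  have -> : z != w by apply/eqP => h; move: k2; rewrite -fz -fw h eqxx.
  by rewrite leq_addr.
apply: (@leq_trans ((\sum_(t : H * H * H) \sum_(f : {ffun H -> 'I_n}) Q f t) * n ^ 3)%N).
  by rewrite leq_mul2r; apply/orP; right; rewrite exchange_big.
rewrite big_distrl /=.
apply: (@leq_trans (\sum_(t : H * H * H) n ^ nvert H)%N); last first.
  by rewrite sum_nat_const !card_prod /nvert !expnS expn0 muln1 mulnA.
apply: leq_sum => -[[x z] w] _; rewrite /Q /=.
case: (boolP (x != z)) => [xz|_]; last by rewrite big1.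
case: (boolP (x != w)) => [xw|_]; last by rewrite big1.
case: (boolP (z != w)) => [zw|_]; last by rewrite big1.
pose F (i : H) : pred 'I_n := fun a => if i == x then a == (val e).1 else
  if i == z then a == (val e).2 else if i == w then a == k else true.
have zx : z != x by rewrite eq_sym.
have wx : w != x by rewrite eq_sym.
have wz : w != z by rewrite eq_sym.
have Fx : #|F x| = 1%N.
  by rewrite -(card1 (val e).1); apply: eq_card => a; rewrite unfold_in /F eqxx.
have Fz : #|F z| = 1%N.
  rewrite -(card1 (val e).2); apply: eq_card => a.
  by rewrite unfold_in /F (negbTE zx) eqxx.
have Fw : #|F w| = 1%N.
  rewrite -(card1 k); apply: eq_card => a.
  by rewrite unfold_in /F (negbTE wx) (negbTE wz) eqxx.
have Fo i : i != x -> i != z -> i != w -> #|F i| = n.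
  move=> h1 h2 h3; rewrite -[RHS](card_ord n); apply: eq_card => a.
  by rewrite unfold_in /F (negbTE h1) (negbTE h2) (negbTE h3).
have -> : (\sum_(f : {ffun H -> 'I_n}) [&& true, true, true, f x == (val e).1, f z == (val e).2 & f w == k]
   = #|family F|)%N.
  rewrite -sum1_card [RHS]big_mkcond; apply: eq_bigr => f _ /=.
  suff -> : (f \in family F) = [&& f x == (val e).1, f z == (val e).2 & f w == k] by case: ifP.
  apply/familyP/and3P => [h|[h1 h2 h3] i].
    have := h x; have := h z; have := h w.
    by rewrite !unfold_in /F !eqxx (negbTE zx) (negbTE wx) (negbTE wz).
  rewrite unfold_in /F; case: eqP => [->|_]; first exact: h1.
  case: eqP => [->|_]; first exact: h2.
  by case: eqP => [->|_] //; exact: h3.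
have -> : (n ^ nvert H = \prod_(i : H) n)%N by rewrite prod_nat_const.
rewrite card_family foldrE big_map big_enum /=.
have wP : (w != x) && (w != z) by rewrite wx wz.
rewrite (bigD1 x) //= (bigD1 z) //= (bigD1 w) //=.
rewrite [leqRHS](bigD1 x) //= (bigD1 z zx) /= (bigD1 w wP) /=.
rewrite Fx Fz Fw !mul1n.
rewrite (eq_bigr (fun=> n)); last first.
  by move=> i /andP[/andP[h1 h2] h3]; apply: Fo.
by rewrite mulnC !expnS expn0 muln1 !mulnA.
Qed.

End Embeddings.

(** The falling factorial is n^m up to a relative error O(1/n), multiplied out to stay in the
    naturals. The induction uses (m + 2)^2 + (m + 2) <= (m + 3)^2. *)
Lemma ffact_lower (n m : nat) : (2 <= n)%N ->
  (n ^ m.+1 <= n * (n - 2) ^_ m + (m + 2) ^ 2 * n ^ m)%N.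
Proof.
move=> n2; elim: m => [|m IH]; first by rewrite ffactn0 expn0 expn1 !muln1 leq_addr.
set X := ((n - 2) ^_ m)%N in IH *.
have hX : (X <= n ^ m)%N.
  by apply: ffact_le_exp; apply: leq_subr.
have e1 : (n * X <= X * (n - 2 - m) + (m + 2) * X)%N.
  by rewrite [(X * _)%N]mulnC -mulnDl leq_mul2r; apply/orP; right; lia.
rewrite ffactnSr expnS.
apply: (@leq_trans (n * (n * X + (m + 2) ^ 2 * n ^ m))%N); first by rewrite leq_mul2l IH orbT.
have e2 : (n * (n * X) <= n * (X * (n - 2 - m) + (m + 2) * X))%N by rewrite leq_mul2l e1 orbT.
have e3 : (n * ((m + 2) * X) <= (m + 2) * n ^ m.+1)%N.
  by rewrite mulnCA expnS !leq_mul2l hX !orbT.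
have e4 : (n * ((m + 2) ^ 2 * n ^ m) = (m + 2) ^ 2 * n ^ m.+1)%N by rewrite [(n ^ m.+1)%N]expnS mulnCA.
rewrite mulnDr e4; move: e2 e3; rewrite -/X mulnDr.
move: (n ^ m.+1)%N (n * (X * _))%N (n * (n * X))%N (n * (_ * X))%N => a b c d.
nia.
Qed.

(** * The Hamiltonian as a polynomial: degrees, codegrees and mean-field values *)

Section System.
Variables (R : realType) (k : nat) (Hs : 'I_k.+1 -> sgraph) (beta : 'I_k.+1 -> R).
Hypothesis v2 : forall j, (2 <= nvert (Hs j))%N.

(** One constant for all estimates of the section: the three summands cover the degree error, the
    codegrees and the mean, and the last factor covers every admissible weight. *)
Definition sysC : R := 2 * \sum_j `|beta j| *
  (2 * (nedge (Hs j))%:R * (nvert (Hs j))%:R ^+ 2 + (nvert (Hs j))%:R ^+ 3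
   + 2 * (nedge (Hs j))%:R) * (1 + (nedge (Hs j))%:R) ^+ 2.

Lemma sysC_ge0 : 0 <= sysC.
Proof.
by rewrite mulr_ge0 // sumr_ge0.
Qed.

(** The function 2 Phi as a formal polynomial. For a single graph with coefficient 1 it is 2 e
    a^(e-1). *)
Definition mean_poly : {poly R} :=
  \sum_j (2 * beta j * (nedge (Hs j))%:R) *: 'X^(nedge (Hs j) - 1).

Lemma mean_polyE a : mean_poly.[a] =
  \sum_j 2 * beta j * (nedge (Hs j))%:R * a ^+ (nedge (Hs j) - 1).
Proof.
by rewrite /mean_poly horner_sum; apply: eq_bigr => j _; rewrite hornerZ hornerXn.
Qed.

Lemma mean_poly_derivE a : mean_poly^`().[a] =
  \sum_j 2 * beta j * (nedge (Hs j))%:R *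
    ((nedge (Hs j) - 1)%:R * a ^+ (nedge (Hs j) - 2)).
Proof.
rewrite /mean_poly raddf_sum horner_sum; apply: eq_bigr => j _ /=.
rewrite derivZ hornerZ derivXn hornerMn hornerXn.
have -> : ((nedge (Hs j) - 1).-1 = nedge (Hs j) - 2)%N by lia.
by rewrite -[_ *+ (_ - 1)]mulr_natl.
Qed.

Variable n : nat.
Hypothesis n2 : (2 <= n)%N.

(* The exponent of the Gibbs weight is a polynomial with one monomial for each
   map from some [Hs j] to the vertices; non-injective maps get coefficient 0. *)
Definition sysT : finType := {j : 'I_k.+1 & {ffun Hs j -> 'I_n}}.

Definition sysu (t : sysT) : R :=
  beta (tag t) / n%:R ^+ (nvert (Hs (tag t)) - 2) * (injectiveb (tagged t))%:R.

Definition sysA (t : sysT) : {set vpair n} := eset (tagged t).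

Lemma sys_sum (F : forall j, {ffun Hs j -> 'I_n} -> R) :
  \sum_(t : sysT) F (tag t) (tagged t) = \sum_j \sum_(f : {ffun Hs j -> 'I_n}) F j f.
Proof. by rewrite sig_big_dep. Qed.

Lemma n_gt0 : 0 < (n%:R : R).
Proof. by rewrite ltr0n; apply: leq_trans n2. Qed.

Lemma sys_polyE y : poly_of sysu sysA y =
  \sum_j beta j / n%:R ^+ (nvert (Hs j) - 2) * #|injhom (Hs j) (config_graph y)|%:R.
Proof.
rewrite /poly_of (sys_sum (fun j f => beta j / n%:R ^+ (nvert (Hs j) - 2) *
  (injectiveb f)%:R * mono R (eset f) y)).
apply: eq_bigr => j _; rewrite injhomE mulr_sumr.
by apply: eq_bigr => f _; rewrite mulrA.
Qed.

Lemma degree_approx (H : sgraph) (e : vpair n) : (2 <= nvert H)%N ->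
  `|(degree H e)%:R / n%:R ^+ (nvert H - 2) - 2 * (nedge H)%:R|
   <= 2 * (nedge H)%:R * (nvert H)%:R ^+ 2 / n%:R :> R.
Proof.
move=> vH; have np := n_gt0; have npm : 0 < (n%:R : R) ^+ (nvert H - 2) by apply: exprn_gt0.
have hle : (degree H e)%:R <= 2 * (nedge H)%:R * n%:R ^+ (nvert H - 2) :> R.
  by have := degree_le e vH; rewrite -(ler_nat R) !natrM natrX.
have := ffact_lower (nvert H - 2) n2; rewrite subnK // -(ler_nat R).
rewrite natrD !natrM !natrX exprS => hlow.
have hd : (degree H e)%:R = 2 * (nedge H)%:R * ((n - 2) ^_ (nvert H - 2))%:R :> R.
  by rewrite degreeE // !natrM.
rewrite ler_norml; apply/andP; split; last first.
  apply: (@le_trans _ _ 0); first by rewrite subr_le0 ler_pdivrMr.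
  by rewrite divr_ge0 // !mulr_ge0.
rewrite hd; move: hlow npm; set X := ((n - 2) ^_ _)%:R; set N := n%:R ^+ _.
set E := (nedge H)%:R; set V := (nvert H)%:R ^+ 2 => hlow npm.
have e0 : 0 <= E by [].
rewrite -subr_ge0 (_ : _ - _ = 2 * E * (n%:R * X + V * N - n%:R * N) / (n%:R * N)).
  by rewrite divr_ge0 ?mulr_ge0 ?subr_ge0 ?(ltW np) ?(ltW npm).
by field; rewrite !lt0r_neq0.
Qed.

(** Weights depending on the size of a monomial. Quadratic growth is enough, since the influences of
    the Laplacian count two further edges of a monomial. *)
Definition admissible (psi : nat -> R) := forall m, `|psi m| <= (1 + m%:R) ^+ 2.

Lemma sys_degree psi (e : vpair n) : admissible psi ->
  `|\sum_(t : sysT) sysu t * (e \in sysA t)%:R * psi #|sysA t|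
    - \sum_j 2 * beta j * (nedge (Hs j))%:R * psi (nedge (Hs j))| <= sysC / n%:R.
Proof.
move=> hpsi; have np := n_gt0.
rewrite (sys_sum (fun j f => beta j / n%:R ^+ (nvert (Hs j) - 2) *
  (injectiveb f)%:R * (e \in eset f)%:R * psi #|eset f|)).
rewrite -sumrB; apply: le_trans (ler_norm_sum _ _ _) _.
rewrite /sysC mulr_sumr mulr_suml; apply: ler_sum => j _.
set b := beta j; set E := nedge (Hs j); set V := nvert (Hs j).
have -> : \sum_(f : {ffun Hs j -> 'I_n}) b / n%:R ^+ (V - 2) * (injectiveb f)%:R
    * (e \in eset f)%:R * psi #|eset f| = b * psi E * ((degree (Hs j) e)%:R / n%:R ^+ (V - 2)).
  rewrite /degree natr_sum [X in _ = _ * (X / _)]big_mkcond /= mulr_suml mulr_sumr.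
  apply: eq_bigr => f _; case: injectiveP => [fi|_]; last by rewrite !(mulr0, mul0r).
  by rewrite card_eset //= mulr1 -/E; ring.
have -> : b * psi E * ((degree (Hs j) e)%:R / n%:R ^+ (V - 2)) - 2 * b * E%:R * psi E
  = b * psi E * ((degree (Hs j) e)%:R / n%:R ^+ (V - 2) - 2 * E%:R) by ring.
rewrite !normrM.
have h1 := degree_approx e (v2 j); rewrite -/E -/V in h1.
have h2 := hpsi E.
have h3 := ler_pM (normr_ge0 _) (normr_ge0 _) h2 h1.
have h4 := ler_wpM2l (normr_ge0 b) h3.
rewrite mulrA in h4; apply: le_trans h4 _.
rewrite !mulrA ler_wpM2r ?invr_ge0 ?(ltW np) //.
have b0 : 0 <= `|b| by []. have E0 : 0 <= (E%:R : R) by []. have V0 : 0 <= (V%:R : R) by [].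
have w0 : 0 <= `|b| * (1 + E%:R) ^+ 2 by rewrite mulr_ge0 // sqr_ge0.
have x0 : 0 <= E%:R * V%:R ^+ 2 :> R by rewrite mulr_ge0 // exprn_ge0.
have y0 : 0 <= V%:R ^+ 3 :> R by rewrite exprn_ge0.
have : 0 <= (`|b| * (1 + E%:R) ^+ 2) * (2 * (E%:R * V%:R ^+ 2) + 2 * V%:R ^+ 3 + 4 * E%:R).
  by rewrite mulr_ge0 // !addr_ge0 // mulr_ge0.
move=> h5; rewrite -subr_ge0; apply: le_trans h5 _.
by rewrite le_eqVlt; apply/orP; left; apply/eqP; ring.
Qed.

Lemma sys_codegree psi (e e' : vpair n) : admissible psi ->
  `|\sum_(t : sysT) sysu t * (e \in sysA t)%:R * (e' \in sysA t :\ e)%:R * psi #|sysA t| |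
   <= sysC / n%:R.
Proof.
move=> hpsi; have np := n_gt0.
have [eqe|ne] := eqVneq e e'.
  rewrite big1 ?normr0; first by rewrite divr_ge0 ?sysC_ge0 // ltW.
  by move=> t _; rewrite -eqe !inE eqxx mulr0 mul0r.
rewrite (sys_sum (fun j f => beta j / n%:R ^+ (nvert (Hs j) - 2) *
  (injectiveb f)%:R * (e \in eset f)%:R * (e' \in eset f :\ e)%:R * psi #|eset f|)).
apply: le_trans (ler_norm_sum _ _ _) _.
rewrite /sysC mulr_sumr mulr_suml; apply: ler_sum => j _.
set b := beta j; set E := nedge (Hs j); set V := nvert (Hs j).
set c := (\sum_(f : {ffun Hs j -> 'I_n}) ((e \in eset f) && (e' \in eset f)))%N.
have hc : c%:R <= V%:R ^+ 3 * n%:R ^+ (V - 2) / n%:R :> R.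
  rewrite ler_pdivlMr // -(ler_pM2r (exprn_gt0 2 np)).
  have := codegree_le (Hs j) ne; rewrite -(ler_nat R) !natrM !natrX -/c -/V.
  by rewrite -!mulrA -!exprS -exprD subnK // v2.
have h2 := hpsi E; have V2p : 0 < n%:R ^+ (V - 2) :> R by rewrite exprn_gt0.
apply: (@le_trans _ _ (`|b| / n%:R ^+ (V - 2) * (1 + E%:R) ^+ 2 * c%:R)).
  rewrite /c natr_sum mulr_sumr; apply: le_trans (ler_norm_sum _ _ _) _.
  apply: ler_sum => f _; rewrite in_setD1.
  case: injectiveP => [fi|_]; last first.
    by rewrite !(mulr0, mul0r) normr0 !mulr_ge0 ?invr_ge0 ?sqr_ge0 // ltW.
  case: (e \in eset f); last by rewrite !(mulr0, mul0r) normr0.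
  rewrite eq_sym ne /=; case: (e' \in eset f); last by rewrite !(mulr0, mul0r) normr0.
  rewrite card_eset // !mulr1 !normrM normfV (ger0_norm (ltW V2p)) -/E.
  by rewrite ler_wpM2l // divr_ge0 // ltW.
apply: (@le_trans _ _ (`|b| / n%:R ^+ (V - 2) * (1 + E%:R) ^+ 2 * (V%:R ^+ 3 * n%:R ^+ (V - 2) / n%:R))).
  by rewrite ler_wpM2l // mulr_ge0 ?sqr_ge0 // divr_ge0 // ltW.
have -> : `|b| / n%:R ^+ (V - 2) * (1 + E%:R) ^+ 2 * (V%:R ^+ 3 * n%:R ^+ (V - 2) / n%:R)
   = `|b| * V%:R ^+ 3 * (1 + E%:R) ^+ 2 / n%:R :> R.
  by field; rewrite !lt0r_neq0.
rewrite ler_wpM2r ?invr_ge0 ?(ltW np) //.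
have b0 : 0 <= `|b| by []. have E0 : 0 <= (E%:R : R) by []. have V0 : 0 <= (V%:R : R) by [].
have w0 : 0 <= `|b| * (1 + E%:R) ^+ 2 by rewrite mulr_ge0 // sqr_ge0.
have x0 : 0 <= E%:R * V%:R ^+ 2 :> R by rewrite mulr_ge0 // exprn_ge0.
have y0 : 0 <= V%:R ^+ 3 :> R by rewrite exprn_ge0.
have : 0 <= (`|b| * (1 + E%:R) ^+ 2) * (4 * (E%:R * V%:R ^+ 2) + V%:R ^+ 3 + 4 * E%:R).
  by rewrite mulr_ge0 // !addr_ge0 // mulr_ge0.
move=> h5; rewrite -subr_ge0; apply: le_trans h5 _.
by rewrite le_eqVlt; apply/orP; left; apply/eqP; ring.
Qed.

Lemma sys_mean_bound psi : admissible psi ->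
  `|\sum_j 2 * beta j * (nedge (Hs j))%:R * psi (nedge (Hs j))| <= sysC.
Proof.
move=> hpsi; apply: le_trans (ler_norm_sum _ _ _) _.
rewrite /sysC mulr_sumr; apply: ler_sum => j _.
set b := beta j; set E := nedge (Hs j); set V := nvert (Hs j).
have h2 := hpsi E; rewrite !normrM !normr_nat.
have w0 : 0 <= 2 * `|b| * E%:R by rewrite !mulr_ge0.
apply: le_trans (ler_wpM2l w0 h2) _.
have s0 : 0 <= (1 + E%:R) ^+ 2 :> R by rewrite sqr_ge0.
have x0 : 0 <= 2 * E%:R * V%:R ^+ 2 + V%:R ^+ 3 + E%:R :> R.
  by rewrite !addr_ge0 // ?mulr_ge0 ?exprn_ge0.
have := mulr_ge0 (mulr_ge0 (normr_ge0 b) x0) s0.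
move: s0; move: ((1 + E%:R) ^+ 2) (V%:R ^+ 2) (V%:R ^+ 3) => s v w s0 h5.
by rewrite -subr_ge0; nra.
Qed.

Lemma sys_degree_bound psi (e : vpair n) : admissible psi ->
  `|\sum_(t : sysT) sysu t * (e \in sysA t)%:R * psi #|sysA t| | <= 2 * sysC.
Proof.
move=> hpsi; have h1 := sys_degree e hpsi; have h2 := sys_mean_bound hpsi.
have h3 : sysC / n%:R <= sysC.
  rewrite ler_pdivrMr ?n_gt0 // ler_peMr ?sysC_ge0 // ler1n.
  exact: leq_trans n2.
move: h1 h2; rewrite !ler_norml; set X := \sum_t _; set Y := \sum_j _; lra.
Qed.

Lemma admissible_cst1 : admissible (fun=> 1).
Proof. by move=> m; rewrite normr1 exprn_ege1 // lerDl. Qed.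

Lemma admissibleX (a : R) : 0 <= a <= 1 -> admissible (fun m => a ^+ (m - 1)).
Proof.
move=> /andP[a0 a1] m; rewrite ger0_norm ?exprn_ge0 //.
by apply: (@le_trans _ _ 1); [exact: exprn_ile1|rewrite exprn_ege1 // lerDl].
Qed.

Lemma admissible_nat (d : nat) : admissible (fun m => (m - d)%:R).
Proof.
move=> m; rewrite ger0_norm //; apply: (@le_trans _ _ m%:R).
  by rewrite ler_nat leq_subr.
by have : 0 <= (m%:R : R) by []; nra.
Qed.

Lemma admissible_natM (c d : nat) (b : R) : 0 <= b <= 1 ->
  admissible (fun m => (m - c)%:R * (b * (m - d)%:R)).
Proof.
move=> /andP[b0 b1] m; have m0 : 0 <= (m%:R : R) by [].
have hc : (m - c)%:R <= m%:R :> R by rewrite ler_nat leq_subr.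
have hd : (m - d)%:R <= m%:R :> R by rewrite ler_nat leq_subr.
rewrite ger0_norm ?mulr_ge0 //; apply: (@le_trans _ _ (m%:R * (1 * m%:R))).
  by apply: ler_pM; rewrite ?mulr_ge0 // ler_pM.
by nra.
Qed.

Lemma admissible_deriv (a : R) : 0 <= a <= 1 ->
  admissible (fun m => (m - 1)%:R * a ^+ (m - 2)).
Proof.
move=> /andP[a0 a1] m; rewrite ger0_norm ?mulr_ge0 ?exprn_ge0 //.
apply: (@le_trans _ _ (m - 1)%:R); first by rewrite ler_piMr // exprn_ile1.
by apply: le_trans _ (admissible_nat 1 m); rewrite ler_norm.
Qed.

Lemma sys_codeg_le e e' : codeg sysu sysA e e' <= sysC / n%:R.
Proof.
apply: le_trans _ (sys_codegree e e' admissible_cst1).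
apply: le_trans _ (ler_norm _); rewrite /codeg.
by rewrite le_eqVlt; apply/orP; left; apply/eqP; apply: eq_bigr => t _; rewrite mulr1.
Qed.

Lemma sum_in (B : {set vpair n}) : \sum_e (e \in B)%:R = #|B|%:R :> R.
Proof.
by rewrite -sum1_card natr_sum [RHS]big_mkcond; apply: eq_bigr => e _; case: (e \in B).
Qed.

Lemma sys_codeg_sum e : \sum_e' codeg sysu sysA e e' <= 2 * sysC.
Proof.
apply: le_trans _ (sys_degree_bound e (admissible_nat 1)).
apply: le_trans _ (ler_norm _); rewrite /codeg exchange_big /=.
rewrite le_eqVlt; apply/orP; left; apply/eqP; apply: eq_bigr => t _.
rewrite -mulr_sumr sum_in; case: (boolP (e \in sysA t)) => eA.
  by rewrite (cardsD1 e (sysA t)) eA add1n subn1.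
by rewrite !(mulr0, mul0r).
Qed.

Lemma sys_mean (a : R) e y : 0 <= a <= 1 ->
  `|avg a (enum (vpair n)) (disc e (poly_of sysu sysA)) y - mean_poly.[a]| <= sysC / n%:R.
Proof.
move=> a01; rewrite avg_disc_poly // mean_polyE.
exact: (sys_degree e (admissibleX a01)).
Qed.

Local Notation lapu := (lap_coeff sysu sysA).
Local Notation lapA := (lap_set sysA).

Lemma lap_sum (F : sysT -> vpair n -> R) :
  \sum_(te : sysT * vpair n) F te.1 te.2 = \sum_t \sum_e F t e.
Proof. by rewrite pair_big. Qed.

(** A monomial containing both edges is counted once for each removed edge other than these two. *)
Lemma lap_codegE e' e'' : codeg lapu lapA e' e'' =
  \sum_t sysu t * (e' \in sysA t)%:R * (e'' \in sysA t :\ e')%:R * (#|sysA t| - 2)%:R.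
Proof.
rewrite /codeg /lap_coeff /lap_set (lap_sum (fun t e => sysu t * (e \in sysA t)%:R *
  (e' \in sysA t :\ e)%:R * (e'' \in (sysA t :\ e) :\ e')%:R)).
apply: eq_bigr => t _; set B := sysA t.
rewrite (eq_bigr (fun e => sysu t * (e' \in B)%:R * (e'' \in B :\ e')%:R *
  (e \in (B :\ e') :\ e'')%:R)); last first.
  move=> e _; rewrite !in_setD1 (eq_sym e e') (eq_sym e e'').
  case: (e \in B); case: (e' \in B); case: (e'' \in B); case: (e' == e);
    by case: (e'' == e); case: (e'' == e'); rewrite /= ?(mulr0, mul0r, mulr1).
rewrite -mulr_sumr sum_in.
case: (boolP (e' \in B)) => h1; last by rewrite !(mulr0, mul0r).
case: (boolP (e'' \in B :\ e')) => h2; last by rewrite !(mulr0, mul0r).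
by rewrite (cardsD1 e' B) h1 (cardsD1 e'' (B :\ e')) h2 !add1n subn2.
Qed.

Lemma lap_codeg_le e e' : codeg lapu lapA e e' <= sysC / n%:R.
Proof.
rewrite lap_codegE; apply: le_trans (ler_norm _) _.
exact: (sys_codegree e e' (admissible_nat 2)).
Qed.

Lemma lap_codeg_sum e : \sum_e' codeg lapu lapA e e' <= 2 * sysC.
Proof.
have ad := @admissible_natM 1 2 1; rewrite ler01 lexx in ad.
apply: le_trans _ (sys_degree_bound e (ad isT)).
apply: le_trans _ (ler_norm _).
under eq_bigr do rewrite lap_codegE.
rewrite exchange_big /= le_eqVlt; apply/orP; left; apply/eqP.
apply: eq_bigr => t _; set B := sysA t.
rewrite -mulr_suml -mulr_sumr sum_in mul1r mulrA; congr (_ * _).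
case: (boolP (e \in B)) => h1; last by rewrite !(mulr0, mul0r).
by rewrite (cardsD1 e B) h1 add1n subn1.
Qed.

Lemma lap_mean (a : R) e y : 0 <= a <= 1 ->
  `|avg a (enum (vpair n)) (disc e (laplacian sysu sysA)) y - mean_poly^`().[a]|
  <= sysC / n%:R.
Proof.
move=> a01; have -> : avg a (enum (vpair n)) (disc e (laplacian sysu sysA)) y =
    avg a (enum (vpair n)) (disc e (poly_of lapu lapA)) y.
  by apply: (eq_avg a01) => z; apply: eq_disc; exact: laplacianE.
rewrite avg_disc_poly // mean_poly_derivE.
have := sys_degree e (admissible_deriv a01); congr (`| _ - _ | <= _).
rewrite /lap_coeff /lap_set (lap_sum (fun t e' => sysu t * (e' \in sysA t)%:R *
  (e \in sysA t :\ e')%:R * a ^+ (#|sysA t :\ e'| - 1))).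
apply: eq_bigr => t _; set B := sysA t.
rewrite [RHS](eq_bigr (fun e' => sysu t * (e \in B)%:R * a ^+ (#|B| - 2) * (e' \in B :\ e)%:R)).
  rewrite -mulr_sumr sum_in -!mulrA [a ^+ _ * _]mulrC.
  case: (boolP (e \in B)) => h1; last by rewrite !(mulr0, mul0r).
  by have -> : #|B :\ e| = (#|B| - 1)%N by rewrite (cardsD1 e B) h1 add1n subn1.
move=> e' _; rewrite !in_setD1 (eq_sym e e').
case: (boolP (e' \in B)) => h1; last by rewrite !(andbF, mulr0, mul0r).
rewrite (cardsD1 e' B) h1 add1n subSS.
by case: (e' == e); case: (e \in B); rewrite /= ?(mulr0, mul0r, mulr1).
Qed.

End System.

(** * Assembly *)

(** By the factor theorem q - q(p) = (X - p) h, and on [0,1] the cofactor is at most the sum of its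
    absolute coefficients. *)
Lemma poly_lipschitz (R : realType) (q : {poly R}) (p : R) : exists2 K : R, 0 <= K &
  forall a, 0 <= a <= 1 -> `|q.[a] - q.[p]| <= K * `|a - p|.
Proof.
have /factor_theorem[h hE] : root (q - q.[p]%:P) p by rewrite rootE !hornerE subrr.
exists (\sum_(i < size h) `|h`_i|); first exact: sumr_ge0.
move=> a /andP[a0 a1].
have -> : q.[a] - q.[p] = h.[a] * (a - p).
  by have := congr1 (horner^~ a) hE; rewrite !hornerE.
rewrite normrM ler_wpM2r // horner_coef; apply: le_trans (ler_norm_sum _ _ _) _.
apply: ler_sum => i _; rewrite normrM ler_piMr // ger0_norm ?exprn_ge0 //.
exact: exprn_ile1.
Qed.

Lemma nvert_ge2 (H : sgraph) : (1 <= nedge H)%N -> (2 <= nvert H)%N.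
Proof.
rewrite /nedge card_gt0 => /set0Pn[B /imsetP[[x z]]]; rewrite inE /= => xz _.
have ne : x != z by apply/eqP => h; move: xz; rewrite h adj_irr.
rewrite /nvert; have <- : #|[set x; z]| = 2%N by rewrite cards2 ne.
exact: max_card.
Qed.

Lemma gibbs_P_or (R : realType) (I : finType) (w : {ffun I -> bool} -> R)
    (A B : pred {ffun I -> bool}) (a b : R) : (forall y, 0 < w y) ->
  gibbs_P w A <= a -> gibbs_P w B <= b -> gibbs_P w (fun y => A y || B y) <= a + b.
Proof.
move=> w0 hA hB; apply: (le_trans _ (lerD hA hB)).
rewrite /gibbs_P -gibbs_ED; apply: (le_gibbs_E w0) => y.
by case: (A y); case: (B y); rewrite ?addr0 ?add0r ?lerDl.
Qed.

Lemma scale_exists (n : nat) : (0 < n)%N ->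
  exists2 l, (0 < l)%N & (l ^ 8 <= n < l.+1 ^ 8)%N.
Proof.
move=> n0; pose P l := (l ^ 8 <= n)%N.
have ex : exists l, P l by exists 1%N; rewrite /P exp1n.
have bd l : P l -> (l <= n)%N.
  move=> h; apply: leq_trans h.
  by rewrite -{1}[l]expn1; case: l => // l; rewrite leq_pexp2l.
case: (ex_maxnP ex bd) => l Pl lmax; exists l.
  by apply: lmax; rewrite /P exp1n.
apply/andP; split; first exact: Pl.
rewrite ltnNge; apply/negP => h.
by have := lmax _ h; rewrite ltnn.
Qed.

Section Final.
Variables (R : realType) (k : nat) (Hs : 'I_k.+1 -> sgraph)
    (beta : 'I_k.+1 -> R) (p : R) (H : sgraph).
Hypotheses (Hs_first : single_edge (Hs ord0))
    (Hs_edges : forall j : 'I_k.+1, j != ord0 -> (2 <= nedge (Hs j))%N)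
    (beta_pos : forall j : 'I_k.+1, j != ord0 -> 0 < beta j)
    (Hsubcrit : subcritical_at Hs beta p)
    (H_edge : (1 <= nedge H)%N).

Local Notation q := (mean_poly Hs beta).
(** The observed graph is treated as a system with one graph and coefficient 1, so the estimates for
    the Hamiltonian apply to its count divided by n^(v-2). *)
Local Notation Hs1 := (fun _ : 'I_1 => H).
Local Notation beta1 := (fun _ : 'I_1 => 1 : R).
Local Notation qH := (mean_poly Hs1 beta1).

Let v2 j : (2 <= nvert (Hs j))%N.
Proof.
have [->|/Hs_edges h] := eqVneq j ord0; first by case: Hs_first => ->.
by apply: nvert_ge2; apply: leq_trans h.
Qed.

Let v2H (j : 'I_1) : (2 <= nvert (Hs1 j))%N.
Proof. exact: nvert_ge2. Qed.

Lemma phiE (a : R) : phi Hs beta a = lgs q.[a].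
Proof.
rewrite /phi /lgs mean_polyE /Phi mulr_sumr.
suff -> : \sum_i 2 * (beta i * (nedge (Hs i))%:R * a ^+ (nedge (Hs i) - 1)) =
   \sum_j 2 * beta j * (nedge (Hs j))%:R * a ^+ (nedge (Hs j) - 1) by [].
by apply: eq_bigr => j _; rewrite !mulrA.
Qed.

Lemma sysu_pos n : almost_pos (@sysu R k Hs beta n) (@sysA k Hs n).
Proof.
move=> [j f]; rewrite /sysu /sysA /=; case: (boolP (injectiveb f)) => [/injectiveP fi|_].
  have [j0|/beta_pos b0] := eqVneq j ord0.
    by right; rewrite card_eset //; subst j; case: Hs_first => _ ->.
  by left; rewrite mulr1 divr_ge0 ?exprn_ge0 // ltW.
by left; rewrite mulr0.
Qed.

Lemma sysH_pos n : almost_pos (@sysu R 0 Hs1 beta1 n) (@sysA 0 Hs1 n).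
Proof. by move=> t; left; rewrite mulr_ge0 // divr_ge0 ?exprn_ge0. Qed.

Local Notation gw n := (fun y : config n => expR (poly_of (@sysu R k Hs beta n) (@sysA k Hs n) y)).
Local Notation Hdens n := (poly_of (@sysu R 0 Hs1 beta1 n) (@sysA 0 Hs1 n)).

(** An upper bound suffices for the Laplacian, as only the growth of the conditional probabilities
    has to be limited. *)
Definition typical (r1 r2 : R) n l : pred (config n) :=
  fun y => [forall e : vpair n,
     [&& `|cond_prob (gw n) e y - p| <= r1 * eps R l,
         disc e (laplacian (@sysu R k Hs beta n) (@sysA k Hs n)) y
            <= q^`().[p] + r2 * eps R l &
         `|disc e (Hdens n) y - qH.[p]| <= r2 * eps R l]].

Lemma bad_event : exists r1 r2 C : R, [/\ 0 <= r1, 0 <= r2, 0 <= C &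
  forall n l, (2 <= n)%N -> (0 < l)%N -> (l ^ 8 <= n)%N ->
  gibbs_P (gw n) (predC (typical r1 r2 l))
  <= #|vpair n|%:R * (C / l%:R ^+ 64)].
Proof.
case: Hsubcrit => -[[/andP[p0 p1] fixp] uniqp] slope.
rewrite phiE in fixp.
have uniq_fix a : 0 < a < 1 -> lgs q.[a] = a -> p = a.
  by move=> a01 fa; apply: uniqp; rewrite phiE.
have slope' : derive1 (fun a => lgs q.[a]) p < 1.
  suff <- : phi Hs beta = (fun a => lgs q.[a]) by [].
  by apply/funext => a; apply: phiE.
have p01 : 0 < p < 1 by rewrite p0 p1.
have p01' : 0 <= p <= 1 by rewrite !ltW.
have [theta th01 contr] := mean_field_contraction p01 fixp uniq_fix slope'.
have [K1 K10 lip1] := poly_lipschitz q p.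
have [K2 K20 lip2] := poly_lipschitz q^`() p.
have [K3 K30 lip3] := poly_lipschitz qH p.
have s0 := sysC_ge0 Hs beta; have sH0 := sysC_ge0 Hs1 beta1.
pose K := 1 + K1 + K2 + K3 + 2 * sysC Hs beta + 2 * sysC Hs1 beta1.
have K_ge1 : 1 <= K by rewrite /K; lra.
have [C hC] := tail_bound_decay th01 K_ge1.
pose rt := rate theta K.
have rt0 : 0 <= rt by apply: rate_ge0.
(* Five one-sided tails per edge: two for the conditional probability, one for the Laplacian, two
   for the count of [H]. *)
exists (1 + rt), (2 + K + K * (1 + rt)), (5 * `|C|); split => //.
- by rewrite addr_ge0.
- have K0 : 0 <= K := le_trans ler01 K_ge1.
  by rewrite !addr_ge0 // mulr_ge0 // addr_ge0.
move=> n l n2 l0 l8.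
have [kk [thk tb]] := hC l l0.
have l8' : l%:R ^+ 8 <= n%:R :> R by rewrite -natrX ler_nat.
have lp : 0 < (l%:R : R) by rewrite ltr0n.
have np : 0 < (n%:R : R) by rewrite ltr0n; apply: leq_trans n2.
pose u := @sysu R k Hs beta n; pose A := @sysA k Hs n.
have upos : almost_pos u A := @sysu_pos n.
have tb' : tail_bound K l kk <= `|C| / l%:R ^+ 64.
  by rewrite ler_pdivlMr ?exprn_gt0 //; apply: le_trans tb (ler_norm _).
have KnC : sysC Hs beta / n%:R <= K / n%:R.
  by rewrite ler_wpM2r ?invr_ge0 ?(ltW np) // /K; lra.
have KnCH : sysC Hs1 beta1 / n%:R <= K / n%:R.
  by rewrite ler_wpM2r ?invr_ge0 ?(ltW np) // /K; lra.
have meanM e a : 0 <= a <= 1 ->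
  `|\sum_t u t * (e \in A t)%:R * a ^+ (#|A t| - 1) - q.[a]| <= K / n%:R.
  move=> a01; rewrite mean_polyE; apply: le_trans KnC.
  exact: (sys_degree beta v2 n2 e (admissibleX a01)).
have cmax e e' : codeg u A e e' <= K / n%:R.
  by apply: le_trans KnC; apply: sys_codeg_le.
have csum e : \sum_e' codeg u A e e' <= K.
  apply: le_trans (sys_codeg_sum beta v2 n2 e) _; rewrite /K; lra.
have sg1 : `|1 : R| = 1 by rewrite normr1.
have sgN1 : `|-1 : R| = 1 by rewrite normrN1.
have st := @sigma_tail R _ _ u A upos p theta K n%:R (horner q) l p01' th01 K_ge1 l0 l8'
   contr meanM cmax csum kk thk.
have stat := @stat_tail R _ _ u A upos p theta K n%:R (horner q) l p01' th01 K_ge1 l0 l8'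
   contr meanM cmax csum kk thk.
have st1 e : gibbs_P (gw n) (fun y => ~~ (`|cond_prob (gw n) e y - p| <= (1 + rt) * eps R l))
    <= `|C| / l%:R ^+ 64 + `|C| / l%:R ^+ 64.
  apply: le_trans (gibbs_P_or (w_gt0 _ _) (le_trans (st 1 e sg1) tb') (le_trans (st (-1) e sgN1) tb')).
  apply: (le_gibbs_P (w_gt0 _ _)) => y; rewrite -ltNge mul1r mulN1r.
  by rewrite lter_normr.
have st2 e : gibbs_P (gw n) (fun y => ~~ (disc e (laplacian u A) y <= q^`().[p]
    + (2 + K + K * (1 + rt)) * eps R l)) <= `|C| / l%:R ^+ 64.
  apply: le_trans tb'.
  have := @stat 1 (codeg (lap_coeff u A) (lap_set A) e)
    (disc e (laplacian u A)) (horner q^`()) sg1.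
  move=> /(_ (fun e' y => disc_disc_laplacian upos e e' y)).
  move=> /(_ (fun e' => le_trans (lap_codeg_le beta v2 n2 e e') KnC)).
  have hs : \sum_e' codeg (lap_coeff u A) (lap_set A) e e' <= K.
    by apply: le_trans (lap_codeg_sum beta v2 n2 e) _; rewrite /K; lra.
  move=> /(_ hs (fun a y a01 => le_trans (lap_mean beta v2 n2 e y a01) KnC)).
  have hl a : 0 <= a <= 1 -> `|q^`().[a] - q^`().[p]| <= K * `|a - p|.
    by move=> a01; apply: le_trans (lip2 a a01) _; rewrite ler_wpM2r // /K; lra.
  move/(_ hl); apply: le_trans; apply: (le_gibbs_P (w_gt0 _ _)) => y.
  by rewrite -ltNge mul1r -ltrBrDl.
have st3 e : gibbs_P (gw n) (fun y => ~~ (`|disc e (Hdens n) y - qH.[p]|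
    <= (2 + K + K * (1 + rt)) * eps R l)) <= `|C| / l%:R ^+ 64 + `|C| / l%:R ^+ 64.
  have Hst sg (h : `|sg| = 1) := @stat sg (codeg (@sysu R 0 Hs1 beta1 n) (@sysA 0 Hs1 n) e)
    (disc e (Hdens n)) (horner qH) h
    (fun e' y => disc_disc_poly e e' y (@sysH_pos n))
    (fun e' => le_trans (sys_codeg_le beta1 v2H n2 e e') KnCH).
  have hs : \sum_e' codeg (@sysu R 0 Hs1 beta1 n) (@sysA 0 Hs1 n) e e' <= K.
    by apply: le_trans (sys_codeg_sum beta1 v2H n2 e) _; rewrite /K; lra.
  have hl a : 0 <= a <= 1 -> `|qH.[a] - qH.[p]| <= K * `|a - p|.
    by move=> a01; apply: le_trans (lip3 a a01) _; rewrite ler_wpM2r // /K; lra.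
  have hm a y (a01 : 0 <= a <= 1) := le_trans (sys_mean beta1 v2H n2 e y a01) KnCH.
  apply: le_trans (gibbs_P_or (w_gt0 _ _) (le_trans (Hst 1 sg1 hs hm hl) tb')
    (le_trans (Hst (-1) sgN1 hs hm hl) tb')).
  apply: (le_gibbs_P (w_gt0 _ _)) => y; rewrite -ltNge mul1r mulN1r.
  by rewrite lter_normr.
pose bad e y := (~~ (`|cond_prob (gw n) e y - p| <= (1 + rt) * eps R l) ||
  ~~ (disc e (laplacian u A) y <= q^`().[p] + (2 + K + K * (1 + rt)) * eps R l)) ||
  ~~ (`|disc e (Hdens n) y - qH.[p]| <= (2 + K + K * (1 + rt)) * eps R l).
have hbad e : gibbs_P (gw n) (bad e) <= 5 * `|C| / l%:R ^+ 64.
  apply: le_trans (gibbs_P_or (w_gt0 _ _) (gibbs_P_or (w_gt0 _ _) (st1 e) (st2 e)) (st3 e)) _.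
  by rewrite -mulrA; move: (`|C| / _) => x; lra.
apply: (@le_trans _ _ (gibbs_P (gw n) (fun y => [exists e, bad e y]))).
  apply: (le_gibbs_P (w_gt0 _ _)) => y /=; rewrite /typical negb_forall => /existsP[e he].
  by apply/existsP; exists e; move: he; rewrite /bad !negb_and orbA.
apply: le_trans (gibbs_P_exists (w_gt0 _ _) bad) _.
rewrite -sum1_card natr_sum mulr_suml; apply: ler_sum => e _.
by rewrite mul1r.
Qed.

Lemma Hdens_bound n y : (2 <= n)%N -> `|Hdens n y| <= n%:R ^+ 2.
Proof.
move=> n2; have np : 0 < (n%:R : R) by rewrite ltr0n; apply: leq_trans n2.
rewrite sys_polyE big_ord_recl big_ord0 addr0 mul1r.
rewrite ger0_norm ?mulr_ge0 ?invr_ge0 ?exprn_ge0 //.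
rewrite mulrC ler_pdivrMr ?exprn_gt0 // -exprD addnC subnK ?nvert_ge2 //.
rewrite -natrX ler_nat.
by have := max_card (injhom H (config_graph y)); rewrite card_ffun card_ord.
Qed.

Lemma card_vpair_le n : #|vpair n|%:R <= n%:R ^+ 2 :> R.
Proof.
rewrite -natrX ler_nat -(leq_pmul2r (isT : (0 < 2)%N)) card_vpair.
rewrite expnS expn1 -mulnA leq_mul2l; apply/orP; right.
by apply: leq_trans (leq_pred n) _; rewrite leq_pmulr.
Qed.

Lemma gibbs_cov_le (I : finType) (w F : {ffun I -> bool} -> R) (D : R) :
  (forall y, 0 < w y) -> (forall y, `|F y| <= D) -> gibbs_cov w F F <= D ^+ 2.
Proof.
move=> w0 hF; rewrite /gibbs_cov lerBlDr -[leLHS]addr0 lerD //; last first.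
  by rewrite -expr2 sqr_ge0.
rewrite -(gibbs_E_cst w0 (D ^+ 2)); apply: (le_gibbs_E w0) => y.
rewrite -expr2 -real_normK ?num_real //.
by rewrite ler_pXn2r ?nnegrE // (le_trans (normr_ge0 _) (hF y)).
Qed.

Lemma gibbs_cov_self (I : finType) (w F : {ffun I -> bool} -> R) :
  (forall y, 0 < w y) ->
  gibbs_cov w F F = gibbs_E w (fun y => (F y - gibbs_E w F) ^+ 2).
Proof.
move=> w0; set m := gibbs_E w F.
have -> : gibbs_E w (fun y => (F y - m) ^+ 2) =
    gibbs_E w (fun y => F y * F y) + - (2 * m) * m + m ^+ 2.
  rewrite -[m ^+ 2](gibbs_E_cst w0) {3}/m -gibbs_EZ -!gibbs_ED.
  by apply: eq_gibbs_E => y; ring.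
by rewrite /gibbs_cov -/m; ring.
Qed.

Lemma gibbs_var_ge0 (I : finType) (w F : {ffun I -> bool} -> R) :
  (forall y, 0 < w y) -> 0 <= gibbs_cov w F F.
Proof.
move=> w0; rewrite gibbs_cov_self //; apply: gibbs_E_ge0 => // y.
exact: sqr_ge0.
Qed.

Local Notation X n := (fun y : config n => Hdens n y - qH.[p] * edge_count R y).

Lemma density_variance : exists C : R, forall n l, (2 <= n)%N -> (0 < l)%N ->
  (l ^ 8 <= n < l.+1 ^ 8)%N ->
  gibbs_cov (gw n) (X n) (X n) <= C * (n%:R ^+ 2 / l%:R ^+ 4).
Proof.
have [r1 [r2 [Cb [r10 r20 Cb0 hbad]]]] := bad_event.
have [p01 [fixp slope]] : 0 < p < 1 /\ lgs q.[p] = p /\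
    derive1 (fun a => lgs q.[a]) p < 1.
  case: Hsubcrit => -[[p01 fp] _] sl; split => //; split; first by rewrite -phiE.
  suff <- : phi Hs beta = (fun a => lgs q.[a]) by [].
  by apply/funext => a; apply: phiE.
have sl := slopeE fixp slope.
have /andP[p0 p1] := p01.
(* The number [s] is the limiting value of rho in the bound on the variance of the edge count. *)
pose kap := Num.max 0 q^`().[p]; pose s := p * (1 - p) * kap.
have kap0 : 0 <= kap by rewrite le_max lexx.
have kapq : q^`().[p] <= kap by rewrite le_max lexx orbT.
have s1 : s < 1.
  rewrite /s /kap; case: (leP 0 q^`().[p]) => // _.
  by rewrite mulr0.
have pp : 0 <= p * (1 - p) <= 1.
  by apply/andP; split; nra.
have s0 : 0 <= s by rewrite mulr_ge0 //; case/andP: pp.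
pose M := (r1 + r1 ^+ 2) * (kap + r2) + r2.
have M0 : 0 <= M by rewrite addr_ge0 // mulr_ge0 ?addr_ge0 ?sqr_ge0.
set c := qH.[p].
have c0 : 0 <= c.
  rewrite /c mean_polyE; apply: sumr_ge0 => j _.
  by rewrite !mulr_ge0 // exprn_ge0 // ltW.
pose B2 := 2 ^+ 32 * Cb; have B20 : 0 <= B2 by rewrite mulr_ge0 // exprn_ge0.
pose L := 2 * M / (1 - s).
pose C1 := r2 ^+ 2 * (2 / (1 - s) * (1 + 12 * B2)) + 6 * (1 + c + r2) ^+ 2 * B2.
pose C2 := (1 + c) ^+ 2 * (2 ^+ 16 * L ^+ 8) * L ^+ 2.
have C10 : 0 <= C1.
  have : 0 <= 2 / (1 - s) by rewrite divr_ge0 //; lra.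
  move=> h; apply: addr_ge0; last first.
    by apply: mulr_ge0 => //; apply: mulr_ge0 => //; apply: sqr_ge0.
  by apply: mulr_ge0; [exact: sqr_ge0|apply: mulr_ge0 => //; lra].
have L0 : 0 <= L by apply: divr_ge0; [exact: mulr_ge0|lra].
have C20 : 0 <= C2.
  apply: mulr_ge0; last exact: sqr_ge0.
  by apply: mulr_ge0; [exact: sqr_ge0|apply: mulr_ge0; apply: exprn_ge0].
exists (C1 + C2) => n l n2 l0 /andP[l8 l8'].
have np : 0 < (n%:R : R) by rewrite ltr0n; apply: leq_trans n2.
have lp : 1 <= (l%:R : R) by rewrite ler1n.
have lp0 : 0 < (l%:R : R) by lra.
have n_le : n%:R <= (2 * l%:R) ^+ 8 :> R.
  apply: (@le_trans _ _ (l.+1 ^ 8)%:R); first by rewrite ler_nat ltnW.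
  by rewrite natrX ler_pXn2r ?nnegrE // ?mulr_ge0 // -natr1; lra.
have N_le := card_vpair_le n; have N0 : 0 <= #|vpair n|%:R :> R by [].
set N := #|vpair n|%:R in N_le N0.
set Q := n%:R ^+ 2 / l%:R ^+ 4.
have Q0 : 0 <= Q by rewrite divr_ge0 ?exprn_ge0 // ltW.
have l4 : 1 <= (l%:R : R) ^+ 4 by rewrite exprn_ege1.
have QN : Q <= n%:R ^+ 2 by rewrite ler_pdivrMr ?exprn_gt0 // ler_peMr ?exprn_ge0 // ltW.
(* Since rho <= s + eps M, small [eps] leaves 1 - rho >= (1 - s)/2. Otherwise l^2 <= [L], so [n] is
   bounded and the trivial bound suffices, with constant [C2]. *)
case: (leP (eps R l * M) ((1 - s) / 2)) => hM; last first.
  have hl : l%:R ^+ 2 <= L.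
    rewrite /L ler_pdivlMr; last by lra.
    move: hM; rewrite /eps ltr_pdivlMl ?exprn_gt0 //; nra.
  apply: (@le_trans _ _ (((1 + c) * n%:R ^+ 2) ^+ 2)).
    apply: gibbs_cov_le; first exact: w_gt0.
    move=> y; apply: le_trans (ler_normB _ _) _; rewrite mulrDl mul1r.
    apply: lerD; first exact: Hdens_bound.
    have /andP[h1 h2] := edge_count_bound R y.
    rewrite normrM !ger0_norm // ler_wpM2l //; exact: le_trans h2 N_le.
  apply: (@le_trans _ _ (C2 * Q)); last by rewrite ler_wpM2r // lerDr.
  have h1 : n%:R ^+ 2 <= 2 ^+ 16 * L ^+ 8 :> R.
    apply: (@le_trans _ _ (((2 * l%:R) ^+ 8) ^+ 2)).
      by rewrite ler_pXn2r ?nnegrE ?exprn_ge0 ?mulr_ge0 // ltW.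
    rewrite -exprM exprMn ler_wpM2l ?exprn_ge0 //.
    by rewrite (_ : (8 * 2 = 2 * 8)%N) // exprM ler_pXn2r ?nnegrE ?exprn_ge0 // ltW.
  have h2 : n%:R ^+ 2 <= L ^+ 2 * Q.
    rewrite /Q mulrCA ler_peMr ?exprn_ge0 ?(ltW np) //.
    rewrite ler_pdivlMr ?exprn_gt0 // mul1r (_ : 4%N = (2 * 2)%N) // exprM.
    by rewrite ler_pXn2r ?nnegrE ?exprn_ge0 // ltW.
  have -> : ((1 + c) * n%:R ^+ 2) ^+ 2 = (1 + c) ^+ 2 * (n%:R ^+ 2 * n%:R ^+ 2).
    by rewrite exprMn expr2.
  have -> : C2 * Q = (1 + c) ^+ 2 * ((2 ^+ 16 * L ^+ 8) * (L ^+ 2 * Q)).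
    by rewrite /C2 !mulrA.
  rewrite ler_wpM2l ?sqr_ge0 //.
  by apply: ler_pM; rewrite ?exprn_ge0 // ltW.
have e0 : 0 <= eps R l by rewrite ltW ?eps_gt0.
have e1 : eps R l <= 1 by apply: eps_le1.
set ep := eps R l in hM e0 e1.
pose b := N * (Cb / l%:R ^+ 64).
have b0 : 0 <= b by rewrite mulr_ge0 // divr_ge0 ?exprn_ge0 // ltW.
(* The power l^64 is generous: n <= (2 l)^8 makes n^4 at most 2^32 l^32, which leaves l^(-32) where
   l^(-4) is needed. *)
have n4b : n%:R ^+ 4 * b <= B2 * Q.
  apply: (@le_trans _ _ (n%:R ^+ 4 * (n%:R ^+ 2 * (Cb / l%:R ^+ 64)))).
    by rewrite ler_wpM2l ?exprn_ge0 ?ler_wpM2r ?divr_ge0 ?exprn_ge0 // ltW.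
  have h1 : n%:R ^+ 4 <= 2 ^+ 32 * l%:R ^+ 32 :> R.
    rewrite -exprMn (_ : 32%N = (8 * 4)%N) // exprM.
    by rewrite ler_pXn2r ?nnegrE ?exprn_ge0 ?mulr_ge0 // ltW.
  apply: (@le_trans _ _ ((2 ^+ 32 * l%:R ^+ 32) * (n%:R ^+ 2 * (Cb / l%:R ^+ 64)))).
    rewrite ler_wpM2r // mulr_ge0 ?divr_ge0 ?exprn_ge0 // ltW //.
  have -> : 2 ^+ 32 * l%:R ^+ 32 * (n%:R ^+ 2 * (Cb / l%:R ^+ 64))
     = B2 * (n%:R ^+ 2 / l%:R ^+ 32).
    by rewrite /B2; field; rewrite lt0r_neq0.
  rewrite ler_wpM2l // /Q ler_wpM2l ?exprn_ge0 ?(ltW np) //.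
  by rewrite lef_pV2 ?posrE ?exprn_gt0 // ler_weXn2l.
have hb := hbad n l n2 l0 l8; rewrite -/ep -/N -/b in hb.
set G := typical r1 r2 l in hb.
have n4 : n%:R ^+ 4 = n%:R ^+ 2 * n%:R ^+ 2 :> R by rewrite -exprD.
have nn0 : 0 <= n%:R ^+ 2 :> R by rewrite exprn_ge0.
have VE0 := gibbs_var_ge0 (@edge_count R _) (@w_gt0 R _ _ (@sysu R k Hs beta n) (@sysA k Hs n)).
have VE : gibbs_cov (gw n) (@edge_count R _) (@edge_count R _)
    <= 2 / (1 - s) * (1 + 12 * B2) * n%:R ^+ 2.
  set rho := (p + r1 * ep) * (1 - p + r1 * ep) * (kap + r2 * ep).
  have rho_le : rho <= s + ep * M.
    have h1 : (p + r1 * ep) * (1 - p + r1 * ep) <= p * (1 - p) + ep * (r1 + r1 ^+ 2).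
      have -> : (p + r1 * ep) * (1 - p + r1 * ep) = p * (1 - p) + ep * (r1 + r1 ^+ 2 * ep) by ring.
      by rewrite lerD2l ler_wpM2l // lerD2l ler_piMr // sqr_ge0.
    have h2 : rho <= (p * (1 - p) + ep * (r1 + r1 ^+ 2)) * (kap + r2 * ep).
      by rewrite ler_wpM2r // addr_ge0 // mulr_ge0.
    apply: (le_trans h2); rewrite /s /M mulrDl [p * (1 - p) * _]mulrDr -addrA lerD2l.
    have h3 : p * (1 - p) * (r2 * ep) <= ep * r2.
      rewrite [ep * r2]mulrC ler_piMl ?mulr_ge0 //; by case/andP: pp.
    have h4 : ep * (r1 + r1 ^+ 2) * (kap + r2 * ep) <= ep * (r1 + r1 ^+ 2) * (kap + r2).
      rewrite ler_wpM2l ?mulr_ge0 ?addr_ge0 ?sqr_ge0 // lerD2l ler_piMr //.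
    apply: (le_trans (lerD h3 h4)).
    by rewrite le_eqVlt; apply/orP; left; apply/eqP; ring.
  have rho1 : rho < 1 by apply: (le_lt_trans rho_le); lra.
  have hs y e : G y -> `|cond_prob (gw n) e y - p| <= r1 * ep.
    by move=> /forallP/(_ e)/and3P[].
  have hk y e : G y -> disc e (laplacian (@sysu R k Hs beta n) (@sysA k Hs n)) y <= kap + r2 * ep.
    by move=> /forallP/(_ e)/and3P[_ h _]; apply: (le_trans h); rewrite lerD2r.
  have p01' : 0 <= p <= 1 by rewrite !ltW.
  have := var_edge_count (@sysu_pos n) p01' (mulr_ge0 r10 e0)
    (addr_ge0 kap0 (mulr_ge0 r20 e0)) rho1 hs hk hb.
  rewrite -/rho -/N => h.
  have h5 : (1 - s) / 2 <= 1 - rho by move: hM rho_le; rewrite -/ep; lra.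
  have h6 : 12 * N ^+ 2 * b <= 12 * B2 * n%:R ^+ 2.
    have h61 : N ^+ 2 <= n%:R ^+ 4 by rewrite n4 expr2 ler_pM.
    have h62 : N ^+ 2 * b <= n%:R ^+ 4 * b := ler_wpM2r b0 h61.
    have h63 : B2 * Q <= B2 * n%:R ^+ 2 := ler_wpM2l B20 QN.
    have h64 := le_trans h62 (le_trans n4b h63).
    have := ler_wpM2l (ler0n R 12) h64.
    by rewrite !mulrA.
  have h7 := ler_wpM2r VE0 h5.
  have h8 : (1 - s) / 2 * gibbs_cov (gw n) (@edge_count R _) (@edge_count R _)
     <= (1 + 12 * B2) * n%:R ^+ 2.
    rewrite [leRHS]mulrDl mul1r; apply: (le_trans h7); apply: (le_trans h).
    exact: lerD.
  have s2 : 0 < (1 - s) / 2 by lra.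
  rewrite -(ler_pM2l s2); apply: (le_trans h8).
  rewrite le_eqVlt; apply/orP; left; apply/eqP; field.
  by rewrite lt0r_neq0 //; lra.
have hG3 y e : G y -> `|disc e (Hdens n) y - c| <= r2 * ep.
  by move=> /forallP/(_ e)/and3P[_ _ ].
apply: (le_trans (var_poly (@sysu_pos n) (@sysH_pos n) c0 (mulr_ge0 r20 e0)
   hG3 (fun y => Hdens_bound y n2) hb)).
rewrite -/N.
apply: (@le_trans _ _ (C1 * Q)); last by rewrite ler_wpM2r // lerDl.
have -> : C1 * Q = r2 ^+ 2 * (2 / (1 - s) * (1 + 12 * B2)) * Q
    + 6 * ((1 + c + r2) ^+ 2 * (B2 * Q)) by rewrite /C1; ring.
apply: lerD.
  have -> : r2 ^+ 2 * (2 / (1 - s) * (1 + 12 * B2)) * Q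
     = (r2 * ep) ^+ 2 * (2 / (1 - s) * (1 + 12 * B2) * n%:R ^+ 2).
    rewrite /Q /ep /eps; field; rewrite !lt0r_neq0 ?subr_gt0 //.
  by rewrite ler_wpM2l // sqr_ge0.
rewrite -mulrA ler_wpM2l //.
apply: (@le_trans _ _ (((1 + c + r2) * n%:R ^+ 2) ^+ 2 * b)).
  rewrite ler_wpM2r //.
  have h9 : n%:R ^+ 2 + (c + r2 * ep) * N <= (1 + c + r2) * n%:R ^+ 2.
    rewrite -addrA [leRHS]mulrDl mul1r lerD2l; apply: ler_pM => //.
      by rewrite addr_ge0 // mulr_ge0.
    by rewrite lerD2l ler_piMr.
  have h10 : 0 <= n%:R ^+ 2 + (c + r2 * ep) * N.
    by rewrite addr_ge0 // mulr_ge0 // addr_ge0 // mulr_ge0.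
  by rewrite ler_pXn2r // nnegrE // (le_trans h10 h9).
by rewrite exprMn -exprM -mulrA ler_wpM2l // sqr_ge0.
Qed.

Lemma ergm_EE n (F : config n -> R) : ergm_E Hs beta F = gibbs_E (gw n) F.
Proof.
have wE (y : config n) : ergm_weight Hs beta y = gw n y.
  by rewrite /ergm_weight sys_polyE.
rewrite /ergm_E /gibbs_E /ergm_pmf /ergm_Z; apply: eq_bigr => y _.
by rewrite wE (eq_bigr (gw n)) // => z _; apply: wE.
Qed.

Lemma hom_count_variance : (3 <= nvert H)%N ->
  exists C : R, forall n : nat, (2 <= n)%N ->
    ergm_Var Hs beta (fun y : config n =>
      #|injhom H (config_graph y)|%:R
      - 2 * n%:R ^+ (nvert H - 2) * (nedge H)%:R * p ^+ (nedge H - 1)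
          * (edge_sum R y - ergm_mu Hs beta n))
    <= C * n%:R `^ (2 * (nvert H)%:R - 5 / 2).
Proof.
move=> v3; have [C hC] := density_variance.
(* From n < (l + 1)^8 <= (2 l)^8 follows n^(1/2) <= 16 l^4, that is n^2 / l^4 <= 16 n^(3/2). *)
exists (16 * `|C|) => n n2.
have np : 0 < (n%:R : R) by rewrite ltr0n; apply: leq_trans n2.
have [l l0 hl] := scale_exists (leq_trans (isT : (0 < 2)%N) n2).
have lp : 0 < (l%:R : R) by rewrite ltr0n.
have cpos := w_gt0 (@sysu R k Hs beta n) (@sysA k Hs n).
set F := (fun y : config n => _).
set V := nvert H in v3 F *.
pose c := 2 * n%:R ^+ (V - 2) * (nedge H)%:R * p ^+ (nedge H - 1) * ergm_mu Hs beta n.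
(* The mean of the edge count enters only through an additive constant, which the variance
   ignores. *)
have FE y : F y = n%:R ^+ (V - 2) * X n y + c.
  rewrite /F sys_polyE mean_polyE !big_ord_recl !big_ord0 !addr0 /edge_sum /edge_count /c.
  rewrite -/V; have : n%:R ^+ (V - 2) != 0 :> R by rewrite lt0r_neq0 // exprn_gt0.
  set h := #|_|%:R; set S := \sum_(ij : vpair n) _; set m := ergm_mu _ _ _.
  set P := p ^+ _; set e := (nedge H)%:R; set N := n%:R ^+ _.
  move: h S m P e N => h S m P e N N0.
  by field.
have VarE : ergm_Var Hs beta F = (n%:R ^+ (V - 2)) ^+ 2 * gibbs_cov (gw n) (X n) (X n).
  rewrite /ergm_Var !ergm_EE -gibbs_cov_self //.
  transitivity (gibbs_cov (gw n) (fun y => n%:R ^+ (V - 2) * X n y + c)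
     (fun y => n%:R ^+ (V - 2) * X n y + c)).
    by congr gibbs_cov; apply/funext => y; apply: FE.
  by rewrite gibbs_cov_shift // gibbs_covZl gibbs_covZr mulrA expr2.
rewrite VarE.
have h1 : gibbs_cov (gw n) (X n) (X n) <= `|C| * (n%:R ^+ 2 / l%:R ^+ 4).
  apply: (le_trans (hC n l n2 l0 hl)).
  by rewrite ler_wpM2r ?ler_norm // divr_ge0 ?exprn_ge0 // ltW.
have n0 : (n%:R : R) != 0 by rewrite lt0r_neq0.
have powE : n%:R `^ (2 * V%:R - 5 / 2) = (n%:R ^+ (V - 2)) ^+ 2 * n%:R `^ (3 / 2) :> R.
  rewrite -exprM -powR_mulrn ?(ltW np) // -powRD; last by rewrite n0 implybT.
  congr (_ `^ _); rewrite natrM natrB; last by apply: leq_trans v3.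
  by field.
have h2 : n%:R ^+ 2 <= 16 * l%:R ^+ 4 * n%:R `^ (3 / 2) :> R.
  have -> : n%:R ^+ 2 = n%:R `^ (2^-1) * n%:R `^ (3 / 2) :> R.
    rewrite -powRD; last by rewrite n0 implybT.
    rewrite -powR_mulrn ?(ltW np) //; congr (_ `^ _); by field.
  rewrite ler_wpM2r ?powR_ge0 // powR12_sqrt ?(ltW np) //.
  have -> : 16 * l%:R ^+ 4 = Num.sqrt ((16 * l%:R ^+ 4) ^+ 2) :> R.
    by rewrite sqrtr_sqr ger0_norm // mulr_ge0 // exprn_ge0 // ltW.
  rewrite ler_wsqrtr //.
  case/andP: hl => _ hl; apply: (@le_trans _ _ (l.+1 ^ 8)%:R); first by rewrite ler_nat ltnW.
  have -> : (16 * l%:R ^+ 4) ^+ 2 = (2 * l%:R) ^+ 8 :> R by ring.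
  rewrite natrX ler_pXn2r ?nnegrE ?mulr_ge0 ?(ltW lp) // -natr1.
  have : 1 <= (l%:R : R) by rewrite ler1n.
  lra.
rewrite powE mulrCA; apply: ler_wpM2l; first exact: sqr_ge0.
apply: (le_trans h1).
have -> : 16 * `|C| * n%:R `^ (3 / 2) = `|C| * (16 * n%:R `^ (3 / 2)) by rewrite mulrCA mulrA.
apply: ler_wpM2l => //.
by rewrite ler_pdivrMr ?exprn_gt0 // mulrAC.
Qed.

End Final.

Theorem lemma5p3 (R : realType) (k : nat) (Hs : 'I_k.+1 -> sgraph)
    (beta : 'I_k.+1 -> R) (p : R) (H : sgraph)
    (Hs_first : single_edge (Hs ord0))
    (Hs_isolated : forall j : 'I_k.+1, j != ord0 -> no_isolated (Hs j))
    (Hs_edges : forall j : 'I_k.+1, j != ord0 -> (2 <= nedge (Hs j))%N)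
    (beta_pos : forall j : 'I_k.+1, j != ord0 -> 0 < beta j)
    (Hsubcrit : subcritical_at Hs beta p)
    (H_edge : (1 <= nedge H)%N) (H_vert : (3 <= nvert H)%N) :
  exists C : R, forall n : nat, (2 <= n)%N ->
    ergm_Var Hs beta (fun y : config n =>
      #|injhom H (config_graph y)|%:R
      - 2 * n%:R ^+ (nvert H - 2) * (nedge H)%:R * p ^+ (nedge H - 1)
          * (edge_sum R y - ergm_mu Hs beta n))
    <= C * n%:R `^ (2 * (nvert H)%:R - 5 / 2).
Proof.
exact: (hom_count_variance Hs_first Hs_edges beta_pos Hsubcrit H_edge H_vert).
Qed.
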